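(* Let $m$ be a square-free positive integer with $m=4t+3$ for some integer $t\ge 0$. Then, as an identity of power series in $x$ (equivalently of analytic functions near $x=0$), \[ s_m(x)=\sum_{k=1}^{t}\left(\frac{k}{m}\right)\Lambda_{m,4k}(x)+\sum_{k=t+1}^{2t+1}\left(\frac{k}{m}\right)\Lambda_{m,2m-4k}(x), \] where $\left(\frac{k}{m}\right)$ is the Jacobi symbol.
   Context: For an integer $a$ and odd positive integer $l$, $\left(\frac{a}{l}\right)$ denotes the Jacobi symbol. For a positive integer $m$ define the Dirichlet series $L_m(s)=\sum_{l>0,\ l \text{ odd}}\left(\frac{-m}{l}\right) l^{-s}$ and $L_{-m}(s)=\sum_{l>0,\ l\text{ odd}}\left(\frac{m}{l}\right) l^{-s}$. Let $K_m=\tfrac12$ if $m=1$ and $K_m=1$ otherwise. Define $c_{m,n}=(2n)!\,L_m(2n+1)\,(K_m\sqrt m)^{-1}\left(\frac{\pi}{2m}\right)^{-2n-1}$ for $n\ge 0$ and $d_{m,n}=(2n-1)!\,L_{-m}(2n)\,(K_m\sqrt m)^{-1}\left(\frac{\pi}{2m}\right)^{-2n}$ for $n\ge1$. The generalized Euler and class numbers are $s_{m,n}=c_{m,n/2}$ for $n$ even and $s_{m,n}=d_{m,(n+1)/2}$ for $n$ odd, and $s_m(x)=\sum_{n\ge0}s_{m,n}\frac{x^n}{n!}$. For integers $0\le p\le m$, $\Lambda_{m,p}(x)=\dfrac{\cos((m-p)x)+\sin(px)}{\cos(mx)}$. *)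

(* Defs.v *)
From HB Require Import structures.
From mathcomp Require Import all_boot all_order all_algebra.
From mathcomp Require Import all_classical all_reals all_analysis.

Set Implicit Arguments.
Unset Strict Implicit.
Unset Printing Implicit Defensive.

Import Order.TTheory GRing.Theory Num.Theory.
Import numFieldNormedType.Exports.

Local Open Scope ring_scope.

Definition square_free (m : nat) : Prop :=
  forall d : nat, (d ^ 2 %| m)%N -> d = 1%N.

(* Meaningful when p is an odd prime. *)
Definition legendre (a : int) (p : nat) : int :=
  if (p%:Z %| a)%Z then 0
  else if [exists x : 'I_p, (x%:Z ^+ 2 == a %[mod p%:Z])%Z] then 1
  else -1.

(* Meaningful when l is odd and positive; prime_decomp l lists the pairs
   (p, e) of the factorization of l. *)
Definition jacobi (a : int) (l : nat) : int :=
  \prod_(f <- prime_decomp l) legendre a f.1 ^+ f.2.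

(* L_m(s) for a nonzero index m of either sign and a natural number s >= 1,
   summed over l = 2k + 1 in increasing order: for s = 1 the series is in
   general only conditionally convergent. *)
Definition dirichletL (R : realType) (m : int) (s : nat) : R :=
  limn (series (fun k : nat =>
    (jacobi (- m) k.*2.+1)%:~R / (k.*2.+1)%:R ^+ s : R)).

Definition Kconst (R : realType) (m : nat) : R :=
  if m == 1%N then 2^-1 else 1.

Definition cnum (R : realType) (m n : nat) : R :=
  ((2 * n)`!)%:R * dirichletL R m%:Z (2 * n + 1)
    * (Kconst R m * Num.sqrt m%:R)^-1 * (pi / (2 * m%:R)) ^- (2 * n + 1).

(* Only used for n >= 1. *)
Definition dnum (R : realType) (m n : nat) : R :=
  ((2 * n - 1)`!)%:R * dirichletL R (- m%:Z) (2 * n)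
    * (Kconst R m * Num.sqrt m%:R)^-1 * (pi / (2 * m%:R)) ^- (2 * n).

Definition snum (R : realType) (m n : nat) : R :=
  if odd n then dnum R m n.+1./2 else cnum R m n./2.

(* Partial sums of s_m(x). *)
Definition sseries (R : realType) (m : nat) (x : R) : R^nat :=
  series (fun n : nat => snum R m n * (x ^+ n / (n`!)%:R)).

Definition Lambda (R : realType) (m p : int) (x : R) : R :=
  (cos ((m - p)%:~R * x) + sin (p%:~R * x)) / cos (m%:~R * x).

(* Main.v *)
Require Import Defs.
From HB Require Import structures.
From mathcomp Require Import all_boot all_order all_algebra.
From mathcomp Require Import all_classical all_reals all_analysis.
From mathcomp Require cyclic finfield.
From mathcomp.real_closed Require Import complex.
From mathcomp Require Import zify ring lra.

Import Order.TTheory GRing.Theory Num.Theory.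
Import numFieldNormedType.Exports.

Local Open Scope classical_set_scope.
Local Open Scope ring_scope.

(** Let [chi l] be the Jacobi symbol of [l] modulo [m], and put [w = 2 m x / pi].
    Reciprocity gives [(-m / l) = chi l] and [(m / l) = (-1)^((l-1)/2) chi l] for
    odd [l], so that summing the geometric series in [n] turns [s_m(x)] into
    [2 sqrt m / pi] times the sum over odd [l] of
    [chi l (l + (-1)^((l-1)/2) w) / (l^2 - w^2)].
    The Gauss sum [sum_k chi k sin (2 pi k l / m) = chi l sqrt m], folded to
    [k < m/2] because [chi] is odd, replaces [chi l] by sines, and the sums over
    [l] become the partial fraction expansions of [cos ((m-p) x) / cos (m x)] and
    [sin (p x) / cos (m x)].

    The sign of the Gauss sum comes from Gauss's product formula, proved with
    alternating sums of Gaussian binomials; it holds for every odd modulus, and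
    for modulus [p q] it yields quadratic reciprocity.  The partial fractions are
    obtained from a first-order linear differential system satisfied by their
    partial sums up to a Dirichlet kernel. *)

(** * Quadratic characters and the Jacobi symbol *)

(** The square of a Gauss sum determines it only up to sign, and the theorem needs the sign; hence a
    product whose factors have known signs.

    On the analytic side the obstacle is conditional convergence: the series for [L_m(1)] and the
    partial fractions, taken as trigonometric series in the angle, do not converge absolutely.
    Nothing is differentiated or exchanged in the limit. All identities are between finite sums over
    [l], with error bounds uniform in the number of terms, and the existence of [L_m(1)] is itself
    read off from the partial fractions at [w = 0].

    The range [|w| <= 1/2] keeps [w] away from the poles at the odd integers. The angle attached to
    [k] is [2 pi k / m]. It lies below [pi / 2] exactly when [k <= t], where it yields the parameter
    [4 k]; above [pi / 2] it is replaced by its supplement, which yields [2 m - 4 k]. This is the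
    origin of the two sums in the statement. *)

Definition quadchar (F : finFieldType) (a : F) : int :=
  if a == 0 then 0 else if [exists x : F, x ^+ 2 == a] then 1 else -1.

Lemma finfield_prim_root (F : finFieldType) :
  exists z : F, (#|F|.-1).-primitive_root z.
Proof.
have F1 : (1 < #|F|)%N by rewrite (cardD1 0) (cardD1 1) !inE oner_neq0.
have size_rs : size (enum (predC1 (0 : F))) = #|F|.-1.
  by rewrite -cardE cardC1.
have /hasP[z _ zP] : has (#|F|.-1).-primitive_root (enum (predC1 (0 : F))).
  apply: cyclic.has_prim_root; rewrite ?size_rs ?enum_uniq//; first by lia.
  apply/allP => x; rewrite mem_enum !inE => x0; rewrite unity_rootE.
  apply/eqP/(mulfI x0); rewrite -exprS mulr1 prednK ?finfield.expf_card//.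
  by lia.
by exists z.
Qed.

Lemma prim_root_neq0 {C : fieldType} {n} {z : C} : n.-primitive_root z -> z != 0.
Proof.
move=> zP; apply/eqP => z0; have := prim_expr_order zP.
by rewrite z0 expr0n gtn_eqF ?(prim_order_gt0 zP)//= => /esym/eqP; rewrite oner_eq0.
Qed.

Section QuadChar.
Context {F : finFieldType}.
Implicit Types a b x z : F.

Lemma prim_root_log {z} : (#|F|.-1).-primitive_root z ->
  forall a, a != 0 -> exists i, a = z ^+ i.
Proof.
move=> zP a a0; have F1 : (0 < #|F|)%N by rewrite (cardD1 0) !inE.
have /(prim_rootP zP)[i ->] : a ^+ #|F|.-1 = 1; last by exists i.
by apply: (mulfI a0); rewrite -exprS mulr1 prednK ?finfield.expf_card.
Qed.

Lemma quadchar0 : quadchar F 0 = 0.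
Proof. by rewrite /quadchar eqxx. Qed.

Lemma quadchar_sqr x : x != 0 -> quadchar F (x ^+ 2) = 1.
Proof.
by move=> x0; rewrite /quadchar expf_eq0/= (negPf x0); case: existsP => // -[]; exists x.
Qed.

Lemma quadchar1 : quadchar F 1 = 1.
Proof. by rewrite -(expr1n F 2) quadchar_sqr ?oner_neq0. Qed.

Context (oddF : odd #|F|).

(** A square root [z ^+ j] of [z ^+ i] forces [i = 2 j] modulo the even number [#|F|.-1], so [i] is
    even. In terms of exponents multiplicativity is then immediate. *)
Lemma quadchar_prim_root z i :
  (#|F|.-1).-primitive_root z -> quadchar F (z ^+ i) = (-1) ^+ i.
Proof.
move=> zP; have z0 := prim_root_neq0 zP.
rewrite -signr_odd; case: (boolP (odd i)) => oi; last first.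
  have -> : z ^+ i = (z ^+ i./2) ^+ 2 by rewrite -exprM muln2 even_halfK.
  by rewrite quadchar_sqr ?expf_neq0.
rewrite /quadchar expf_eq0 (negPf z0) andbF; case: existsP => // -[x /eqP xE].
have x0 : x != 0.
  by apply: contraNneq (expf_neq0 i z0) => x0; rewrite -xE x0 expr0n.
have [j xj] := prim_root_log zP x x0.
move: xE; rewrite xj -exprM => /eqP; rewrite (eq_prim_root_expr zP) => /eqP ij.
have ev : (2 %| #|F|.-1)%N by rewrite dvdn2; lia.
have : i = j * 2 %[mod 2] by rewrite -(modn_dvdm i ev) -ij modn_dvdm.
by rewrite modnMl modn2 oi.
Qed.

Lemma quadcharM a b : quadchar F (a * b) = quadchar F a * quadchar F b.
Proof.
have [->|a0] := eqVneq a 0; first by rewrite mul0r quadchar0 mul0r.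
have [->|b0] := eqVneq b 0; first by rewrite mulr0 quadchar0 mulr0.
have [z zP] := finfield_prim_root F.
have [[i ->] [j ->]] := (prim_root_log zP a a0, prim_root_log zP b b0).
by rewrite -exprD !quadchar_prim_root// exprD.
Qed.

Lemma quadchar_mulr_self a : a != 0 -> quadchar F a * quadchar F a = 1.
Proof. by move=> a0; rewrite -quadcharM -expr2 quadchar_sqr. Qed.

Lemma prim_root_half {z} : (#|F|.-1).-primitive_root z ->
  z ^+ (#|F|.-1)./2 = -1 /\ (-1 : F) != 1.
Proof.
move=> zP.
have F2 : (0 < (#|F|.-1)./2 < #|F|.-1)%N.
  have : (1 < #|F|)%N by rewrite (cardD1 0) (cardD1 1) !inE oner_neq0.
  by lia.
have z1 : z ^+ (#|F|.-1)./2 != 1.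
  by rewrite -(prim_order_dvd zP) gtnNdvd//; case/andP: F2.
have /eqP : (z ^+ (#|F|.-1)./2) ^+ 2 == 1.
  rewrite -exprM muln2 even_halfK ?(prim_expr_order zP)//.
  by lia.
move=> /eqP; rewrite sqrf_eq1 => /orP[/eqP z1'|/eqP <-//].
by rewrite z1' eqxx in z1.
Qed.

Lemma quadcharN1 : quadchar F (-1) = (-1) ^+ (#|F|.-1)./2.
Proof.
have [z zP] := finfield_prim_root F.
by rewrite -(quadchar_prim_root z _ zP) (prim_root_half zP).1.
Qed.

(** The weight [1 + quadchar F a] counts the square roots of [a]: one for [0], otherwise none or the
    pair [x], [- x], distinct in odd characteristic. *)
Lemma sum_sqr_quadchar {C : comPzRingType} (f : F -> C) :
  \sum_x f (x ^+ 2) = \sum_a (1 + quadchar F a)%:~R * f a.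
Proof.
have [z /prim_root_half[_ N1]] := finfield_prim_root F.
have two0 : (2%:R : F) != 0.
  by apply: contraNneq N1 => two0; rewrite -subr_eq0 -opprD oppr_eq0 -mulr2n two0.
rewrite (partition_big (fun x : F => x ^+ 2) predT)//=; apply: eq_bigr => a _.
rewrite (eq_bigr (fun=> f a)) => [|x /eqP->//].
rewrite sumr_const -mulr_natl; congr (_ * _).
rewrite /quadchar; have [->|a0] := eqVneq a 0.
  rewrite addr0 (eq_card (B := pred1 0)) ?card1// => x.
  by rewrite !inE -[LHS]/(x ^+ 2 == 0) sqrf_eq0.
case: existsP => [[x /eqP xE]|Nx]; last first.
  by rewrite eq_card0// => x; rewrite -[LHS]/(x ^+ 2 == a); apply/negP => xa; apply: Nx; exists x.
have x0 : x != 0 by apply: contraNneq a0 => x0; rewrite -xE x0 expr0n.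
have xNx : x != - x.
  by rewrite -subr_eq0 opprK -mulr2n -mulr_natl mulf_neq0.
rewrite (eq_card (B := pred2 x (- x))) ?card2 ?xNx// => y.
by rewrite -[LHS]/(y ^+ 2 == a) !inE -xE eqf_sqr.
Qed.

Lemma sum_sqr_quadchar0 {C : comPzRingType} (f : F -> C) : \sum_a f a = 0 ->
  \sum_x f (x ^+ 2) = \sum_a (quadchar F a)%:~R * f a.
Proof.
move=> f0; rewrite sum_sqr_quadchar.
under eq_bigr => a _ do rewrite rmorphD mulrDl mul1r.
by rewrite big_split/= -[RHS]add0r; congr (_ + _); exact: f0.
Qed.

Lemma sum_quadchar {C : comPzRingType} : \sum_a (quadchar F a)%:~R = 0 :> C.
Proof.
have := sum_sqr_quadchar (fun=> 1 : C).
under [in RHS]eq_bigr => a _ do rewrite mulr1 rmorphD/=.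
by rewrite big_split/= -[LHS]addr0 => /addrI <-.
Qed.

End QuadChar.

Lemma legendre_quadchar a p : prime p ->
  legendre a p = quadchar 'F_p (a%:~R).
Proof.
move=> pP; have pc := pchar_Fp pP.
rewrite /legendre /quadchar (dvdz_pcharf pc); case: ifP => // _.
have E (x : nat) : (x%:Z ^+ 2 == a %[mod p%:Z])%Z = ((x%:R : 'F_p) ^+ 2 == a%:~R).
  by rewrite eqz_mod_dvd (dvdz_pcharf pc) rmorphB rmorphXn/= subr_eq0.
congr (if _ then _ else _); apply/existsP/existsP => -[x].
  by rewrite E => xa; exists (x : nat)%:R.
move=> xa; have xp : (x < p)%N by rewrite -[X in (_ < X)%N](Fp_cast pP).
by exists (Ordinal xp); rewrite E/= natr_Zp.
Qed.

Section Legendre.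
Context {p : nat} (pP : prime p) (oddp : odd p).

Let oddF : odd #|'F_p|. Proof. by rewrite card_Fp. Qed.

Lemma legendreM a b : legendre (a * b) p = legendre a p * legendre b p.
Proof. by rewrite !legendre_quadchar// rmorphM/= (quadcharM oddF). Qed.

Lemma legendreN1 : legendre (-1) p = (-1) ^+ p./2.
Proof.
rewrite legendre_quadchar// rmorphN1 (quadcharN1 oddF) card_Fp//.
by have -> : p.-1./2 = p./2 by lia.
Qed.

Lemma legendre1 : legendre 1 p = 1.
Proof. by rewrite legendre_quadchar// quadchar1. Qed.

Lemma legendre_mul_self a : ~~ (p%:Z %| a)%Z -> legendre a p * legendre a p = 1.
Proof.
rewrite (dvdz_pcharf (pchar_Fp pP)) => a0.
by rewrite legendre_quadchar// quadchar_mulr_self.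
Qed.

End Legendre.

Lemma legendre_modz a b (p : nat) : (a = b %[mod p%:Z])%Z -> legendre a p = legendre b p.
Proof.
move=> ab; rewrite /legendre; congr (if _ then _ else _).
  by apply/dvdz_mod0P/dvdz_mod0P; rewrite ab.
by congr (if _ then _ else _); apply: eq_existsb => x; rewrite ab.
Qed.

(** Makes [(-1)^((l-1)/2)] multiplicative in odd [l], so that such signs can be carried through a
    prime factorization. *)
Lemma odd_halfM m n : odd m -> odd n -> odd (m * n)./2 = odd m./2 (+) odd n./2.
Proof.
move=> om on.
have [-> ->] : m = (m./2).*2.+1 /\ n = (n./2).*2.+1 by lia.
move: (m./2) (n./2) => x y.
have -> : (x.*2.+1 * y.*2.+1 = (x * y.*2 + x + y).*2.+1)%N by lia.
have half k : (k.*2.+1)./2 = k by lia.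
by rewrite !half !oddD oddM odd_double andbF.
Qed.

(** A common range of primes, independent of [l], lets symbols with different prime lists be
    multiplied factor by factor. *)
Lemma jacobi_prod_lt a l B : (0 < l)%N -> (l < B)%N ->
  jacobi a l = \prod_(0 <= p < B | prime p) legendre a p ^+ logn p l.
Proof.
move=> l0 lB; rewrite /jacobi prime_decompE big_map/=.
rewrite [RHS](bigID (fun p => p \in primes l))/=.
rewrite [X in _ = _ * X]big1 ?mulr1 => [|p /andP[pP]]; last first.
  by rewrite mem_primes pP l0/= => pl; rewrite lognE pP l0 (negPf pl).
rewrite -[RHS]big_filter; apply: perm_big; apply: uniq_perm.
- exact: primes_uniq.
- by rewrite filter_uniq// iota_uniq.
move=> p; rewrite mem_filter mem_index_iota mem_primes l0/=.
case: (boolP (prime p)) => //= pP; case: (boolP (p %| l)%N) => //= pl.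
by rewrite (leq_ltn_trans _ lB)// dvdn_leq.
Qed.

Lemma jacobi1r a : jacobi a 1 = 1.
Proof. by rewrite /jacobi big_nil. Qed.

Lemma jacobiMr a m n : (0 < m)%N -> (0 < n)%N ->
  jacobi a (m * n) = jacobi a m * jacobi a n.
Proof.
move=> m0 n0; have lt_m : (m < (m * n).+1)%N by rewrite ltnS leq_pmulr.
have lt_n : (n < (m * n).+1)%N by rewrite ltnS leq_pmull.
rewrite (jacobi_prod_lt _ _ _ _ (ltnSn _)) ?muln_gt0 ?m0// (jacobi_prod_lt _ _ _ m0 lt_m).
rewrite (jacobi_prod_lt _ _ _ n0 lt_n) -big_split/=.
by apply: eq_bigr => p pP; rewrite lognM// exprD.
Qed.

Lemma jacobi_prime a p : prime p -> jacobi a p = legendre a p.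
Proof. move=> pP; rewrite /jacobi prime_decompE primes_prime// big_seq1/=.
by rewrite logn_prime// eqxx expr1. Qed.

Lemma odd_prime_ind (P : nat -> Prop) :
  P 1%N -> (forall p n, prime p -> odd p -> odd n -> P n -> P (p * n)%N) ->
  forall n, odd n -> P n.
Proof.
move=> P1 PM n; elim/ltn_ind: n => n IH oddn.
have [n1|n1] := leqP n 1; first by move: n1 oddn; case: n {IH} => [|[]].
have pP := pdiv_prime n1; have /dvdnP[k nk] := pdiv_dvd n.
have : odd (k * pdiv n) by rewrite -nk.
rewrite oddM => /andP[oddk oddp]; rewrite nk mulnC; apply: PM => //.
apply: IH => //; rewrite [X in (_ < X)%N]nk ltn_Pmulr ?prime_gt1//.
by rewrite odd_gt0.
Qed.

Lemma jacobi1l l : odd l -> jacobi 1 l = 1.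
Proof.
move: l; apply: odd_prime_ind => [|p n pP oddp oddn IH]; first by rewrite jacobi1r.
by rewrite jacobiMr ?(prime_gt0 pP) ?(odd_gt0 oddn)// IH (jacobi_prime _ _ pP) legendre1.
Qed.

Lemma jacobiMl a b l : odd l -> jacobi (a * b) l = jacobi a l * jacobi b l.
Proof.
move: l; apply: odd_prime_ind => [|p n pP oddp oddn IH]; first by rewrite !jacobi1r mulr1.
rewrite !jacobiMr ?(prime_gt0 pP) ?(odd_gt0 oddn)// IH !(jacobi_prime _ _ pP) (legendreM pP oddp).
by rewrite mulrACA.
Qed.

Lemma jacobiN1 l : odd l -> jacobi (-1) l = (-1) ^+ l./2.
Proof.
move: l; apply: odd_prime_ind => [|p n pP oddp oddn IH]; first by rewrite jacobi1r.
rewrite jacobiMr ?(prime_gt0 pP) ?(odd_gt0 oddn)// IH (jacobi_prime _ _ pP) legendreN1// -exprD.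
rewrite -[LHS]signr_odd -[RHS]signr_odd; congr (_ ^+ nat_of_bool _).
by rewrite odd_halfM// oddD.
Qed.

Lemma jacobi_modz a b (l : nat) : odd l -> (a = b %[mod l%:Z])%Z ->
  jacobi a l = jacobi b l.
Proof.
move: l; apply: odd_prime_ind => [|p n pP oddp oddn IH]; first by rewrite !jacobi1r.
move=> /eqP; rewrite eqz_mod_dvd PoszM => ab.
rewrite !jacobiMr ?(prime_gt0 pP) ?(odd_gt0 oddn)// !(jacobi_prime _ _ pP) IH//; last first.
  by apply/eqP; rewrite eqz_mod_dvd (dvdz_trans _ ab)// dvdz_mull.
congr (_ * _); apply: legendre_modz.
by apply/eqP; rewrite eqz_mod_dvd (dvdz_trans _ ab)// dvdz_mulr.
Qed.

(** * Periodic sums and Gaussian binomials *)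

Lemma modn_mulr_inj m n a b : coprime m n -> (a < m)%N -> (b < m)%N ->
  a * n = b * n %[mod m] -> a = b.
Proof.
move=> mn; wlog ba : a b / (b <= a)%N => [H am bm E|am _].
  by have [ba|/ltnW ab] := leqP b a; [exact: H|apply/esym/H].
move=> /eqP; rewrite eqn_mod_dvd ?leq_mul2r ?ba ?orbT// -mulnBl Gauss_dvdl// => /dvdnP[[|k] kE].
  by lia.
by move: am kE; rewrite mulSn; move: (k * m)%N => x; lia.
Qed.

Section PeriodicSums.
Context {V : nmodType}.
Implicit Types F : nat -> V.

Lemma sum_periodic_shift F n a : (forall x, F (x + n)%N = F x) ->
  \sum_(x < n) F (x + a)%N = \sum_(x < n) F x.
Proof.
case: n => [|n] Fn; first by rewrite !big_ord0.
elim: a => [|a <-]; first by apply: eq_bigr => x _; rewrite addn0.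
rewrite big_ord_recr/= [RHS]big_ord_recl/= addrC; congr (_ + _).
  by rewrite add0n addnS -addSn addnC Fn.
by apply: eq_bigr => x _; rewrite addnS.
Qed.

(** The map [(a, b) -> a n + b m] modulo [m n] is injective, by reduction modulo [m] and modulo [n],
    hence bijective by cardinality. *)
Lemma sum_crt F m n : (0 < m)%N -> (0 < n)%N -> coprime m n ->
  (forall x, F (x %% (m * n))%N = F x) ->
  \sum_(k < m * n) F k = \sum_(a < m) \sum_(b < n) F (a * n + b * m)%N.
Proof.
move=> m0 n0 mn FP.
have mn0 : (0 < m * n)%N by rewrite muln_gt0 m0.
pose h (u : 'I_m * 'I_n) : 'I_(m * n) := Ordinal (ltn_pmod (u.1 * n + u.2 * m) mn0).
have h_inj : injective h.
  move=> [a b] [a' b'] /(congr1 val)/= E; congr pair; apply: val_inj => /=.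
    have : a * n + b * m = a' * n + b' * m %[mod m].
      by rewrite -(modn_dvdm _ (dvdn_mulr n (dvdnn m))) E modn_dvdm ?dvdn_mulr.
    by rewrite ![(_ * n + _)%N]addnC !modnMDl; apply: modn_mulr_inj.
  have : a * n + b * m = a' * n + b' * m %[mod n].
    by rewrite -(modn_dvdm _ (dvdn_mull m (dvdnn n))) E modn_dvdm ?dvdn_mull.
  by rewrite !modnMDl; apply: modn_mulr_inj; rewrite // coprime_sym.
have h_bij : bijective h.
  by apply: inj_card_bij => //; rewrite card_prod !card_ord.
rewrite pair_bigA (reindex h)/=; last exact: onW_bij.
by apply: eq_bigr => -[a b] _ /=; rewrite FP.
Qed.

End PeriodicSums.

Section QBinomial.
Context {C : fieldType} (q : C).

(** The Gaussian binomial. For [j > n] the factor [i = n] is [1 - q ^+ 0 = 0]. Division by zero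
    yields [0], so the identities below assume the denominators nonzero, as [q] will be a root of
    unity. *)
Definition qbin n j : C := \prod_(i < j) ((1 - q ^+ (n - i)) / (1 - q ^+ i.+1)).

Lemma qbin0 n : qbin n 0 = 1. Proof. by rewrite /qbin big_ord0. Qed.

Lemma qbin_small n j : (n < j)%N -> qbin n j = 0.
Proof.
by move=> nj; rewrite /qbin (bigD1 (Ordinal nj))//= subnn subrr mul0r mul0r.
Qed.

Lemma qbinS n j : 1 - q ^+ j.+1 != 0 ->
  qbin n j.+1 * (1 - q ^+ j.+1) = qbin n j * (1 - q ^+ (n - j)).
Proof. by move=> qj; rewrite /qbin big_ord_recr/= -mulrA divfK. Qed.

Lemma qbinSS n j : (forall i, (i <= j)%N -> 1 - q ^+ i.+1 != 0) ->
  qbin n.+1 j.+1 * (1 - q ^+ j.+1) = (1 - q ^+ n.+1) * qbin n j.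
Proof.
elim: j => [|j IH] qj; first by rewrite qbinS ?qj// !qbin0 mulrC.
apply: (mulIf (qj j (leqnSn j))).
rewrite qbinS ?qj// subSS mulrAC IH => [|i ij]; last by rewrite qj// (leq_trans ij).
by rewrite -!mulrA -qbinS ?qj.
Qed.

(** Comes from [1 - q^(n+1) = (1 - q^(n-j)) + q^(n-j) (1 - q^(j+1))]. *)
Lemma qbin_pascal n j : (j <= n)%N -> (forall i, (i <= j)%N -> 1 - q ^+ i.+1 != 0) ->
  qbin n.+1 j.+1 = qbin n j.+1 + q ^+ (n - j) * qbin n j.
Proof.
move=> jn qj; apply: (mulIf (qj j (leqnn j))).
rewrite mulrDl qbinSS// qbinS ?qj//.
have -> : n.+1 = ((n - j) + j.+1)%N by lia.
by rewrite exprD; ring.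
Qed.

Lemma qbin_absorb n j : (forall i, (i <= j)%N -> 1 - q ^+ i.+1 != 0) ->
  (1 - q ^+ (n.+1 - j)) * qbin n.+1 j = (1 - q ^+ n.+1) * qbin n j.
Proof. by move=> qj; rewrite -qbinSS// qbinS ?qj// mulrC. Qed.

(** Pascal's rule merges neighbouring terms into [(1 - q^(n+1-j)) qbin (n+1) j], and absorption
    pulls out the constant factor [1 - q^(n+1)]. *)
Lemma qbin_alt_sumSS n : (forall i, (i <= n.+1)%N -> 1 - q ^+ i.+1 != 0) ->
  \sum_(j < n.+3) (-1) ^+ j * qbin n.+2 j =
  (1 - q ^+ n.+1) * \sum_(j < n.+1) (-1) ^+ j * qbin n j.
Proof.
move=> qn; have qle j (jn : (j <= n.+1)%N) i (ij : (i <= j)%N) := qn i (leq_trans ij jn).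
transitivity (\sum_(j < n.+3) (-1) ^+ j * qbin n.+1 j -
   \sum_(j < n.+2) (-1) ^+ j * (q ^+ (n.+1 - j) * qbin n.+1 j)).
  rewrite big_ord_recl/= [in RHS]big_ord_recl/= !qbin0 -addrA; congr (_ + _).
  rewrite -sumrB; apply: eq_bigr => j _; rewrite /bump/= add1n.
  by rewrite qbin_pascal//; [rewrite exprS; ring|case: j|apply: qle; case: j].
rewrite big_ord_recr/= (qbin_small n.+1)// mulr0 addr0 -sumrB.
transitivity (\sum_(j < n.+2) (1 - q ^+ n.+1) * ((-1) ^+ j * qbin n j)).
  apply: eq_bigr => j _; rewrite [RHS]mulrCA -qbin_absorb; last by apply: qle; case: j.
  by ring.
by rewrite -mulr_sumr big_ord_recr/= (qbin_small n n.+1)// mulr0 addr0.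
Qed.

Lemma qbin_alt_sum h : (forall i, (i < h.*2)%N -> 1 - q ^+ i.+1 != 0) ->
  \sum_(j < h.*2.+1) (-1) ^+ j * qbin h.*2 j = \prod_(i < h) (1 - q ^+ i.*2.+1).
Proof.
elim: h => [|h IH] qh; first by rewrite big_ord1 big_ord0 qbin0 mulr1.
rewrite doubleS qbin_alt_sumSS => [|i ih]; last by rewrite qh// doubleS.
rewrite [RHS]big_ord_recr/= mulrC IH// => i ih.
by rewrite qh// doubleS (leq_trans ih)// -addn2 leq_addr.
Qed.

End QBinomial.

(** * Gauss sums *)

Lemma prim_rootI (C : nzRingType) n (z : C) : (0 < n)%N -> z ^+ n = 1 ->
  (forall i, (0 < i < n)%N -> z ^+ i != 1) -> n.-primitive_root z.
Proof.
move=> n0 zn zi; have [m mP] := prim_order_exists n0 zn.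
move=> /(dvdn_leq n0); rewrite leq_eqVlt => /orP[/eqP<-//|mn].
have := zi m; rewrite (prim_order_gt0 mP) mn => /(_ isT).
by rewrite (prim_expr_order mP) eqxx.
Qed.

Section GaussProduct.
Context {C : fieldType} {N : nat}.
Implicit Type z : C.

Lemma prim_rootV z : N.-primitive_root z -> N.-primitive_root z^-1.
Proof.
move=> zP; apply: prim_rootI (prim_order_gt0 zP) _ _ => [|i /andP[i0 iN]].
  by rewrite exprVn (prim_expr_order zP) invr1.
by rewrite exprVn invr_eq1 -(prim_order_dvd zP) gtnNdvd.
Qed.

Lemma sum_prim_root z (k : nat) : N.-primitive_root z ->
  \sum_(x < N) (z ^+ k) ^+ x = if (N %| k)%N then N%:R else 0.
Proof.
move=> zP; rewrite (prim_order_dvd zP); case: eqVneq => [->|zk].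
  by rewrite (eq_bigr (fun=> 1)) ?sumr_const ?card_ord// => i _; rewrite expr1n.
have : (z ^+ k - 1) * \sum_(x < N) (z ^+ k) ^+ x = 0.
  by rewrite -subrX1 -exprM mulnC exprM (prim_expr_order zP) expr1n subrr.
by move=> /eqP; rewrite mulf_eq0 subr_eq0 (negPf zk) => /eqP.
Qed.

Definition gauss_sum z : C := \sum_(x < N) z ^+ (x ^ 2).

Context (oddN : odd N).

(* For [q = z^-2] the term [(-1)^j qbin (N-1) j] collapses to [z^(j(j+1))];
   completing the square turns [qbin_alt_sum] into the Gauss sum. *)
Lemma gauss_sum_prod z : N.-primitive_root z ->
  gauss_sum z = \prod_(i < N./2) (z ^+ i.*2.+1 - z ^- i.*2.+1).
Proof.
move=> zP; have z0 := prim_root_neq0 zP; set h := N./2.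
have Nh : N = h.*2.+1 by rewrite /h; lia.
have zk k : (z ^+ k == 1) = (N %| k)%N by rewrite (prim_order_dvd zP).
pose q := z ^- 2.
have qk k : q ^+ k = z ^- (2 * k) by rewrite /q exprVn exprM.
have q1 i : (i < h.*2)%N -> 1 - q ^+ i.+1 != 0.
  move=> ih; rewrite subr_eq0 eq_sym qk invr_eq1 zk Gauss_dvdr; last first.
    by rewrite coprimen2.
  by rewrite gtnNdvd// Nh ltnS.
(* The ratio of consecutive terms is [-(1 - q^(2h-j)) / (1 - q^(j+1))], which equals [z^(2(j+1))]
   because [z ^+ N = 1]. *)
have binE j : (j <= h.*2)%N -> (-1) ^+ j * qbin q h.*2 j = z ^+ (j * j.+1).
  elim: j => [|j IH] jh; first by rewrite qbin0 mulr1 mul0n.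
  apply: (mulIf (q1 j jh)).
  rewrite -mulrA qbinS ?q1// exprS mulN1r mulNr mulrA IH; last exact: ltnW.
  have -> : (j.+1 * j.+2 = j * j.+1 + 2 * j.+1)%N by lia.
  rewrite exprD -mulrA -mulrN; congr (_ * _).
  have zj : z ^+ (2 * j.+1) != 0 by rewrite expf_neq0.
  rewrite !qk opprB mulrBr mulr1 divff//; congr (_ - _).
  apply: (mulIf (expf_neq0 (2 * (h.*2 - j)) z0)).
  rewrite mulVf ?expf_neq0// -exprD.
  have -> : (2 * j.+1 + 2 * (h.*2 - j) = N * 2)%N by rewrite Nh; lia.
  by rewrite exprM (prim_expr_order zP) expr1n.
have := qbin_alt_sum q h q1.
rewrite (eq_bigr (fun j : 'I_h.*2.+1 => z ^+ (j * j.+1))) => [E|j _]; last first.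
  by rewrite binE// -ltnS.
 rewrite -Nh in E; have {}E : z ^+ (h.+1 ^ 2) * \sum_(j < N) z ^+ (j * j.+1) =
    z ^+ (h.+1 ^ 2) * \prod_(i < h) (1 - q ^+ i.*2.+1) by rewrite E.
(* The shift [h + 1] is the inverse of [2] modulo [N], so [(j + h + 1)^2] is [j (j + 1) + (h + 1)^2]
   modulo [N]. *)
rewrite /gauss_sum -(@sum_periodic_shift _ (fun x => z ^+ (x ^ 2)) N h.+1); last first.
  move=> x; have -> : ((x + N) ^ 2 = x ^ 2 + N * (2 * x + N))%N by lia.
  by rewrite exprD exprM (prim_expr_order zP) expr1n mulr1.
rewrite -/h; transitivity (z ^+ (h.+1 ^ 2) * \sum_(j < N) z ^+ (j * j.+1)).
  rewrite mulr_sumr; apply: eq_bigr => -[j /= _] _; rewrite -exprD.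
  have -> : ((j + h.+1) ^ 2 = N * j + (h.+1 ^ 2 + j * j.+1))%N by rewrite Nh; lia.
  by rewrite exprD exprM (prim_expr_order zP) expr1n mul1r.
rewrite E; have -> : z ^+ (h.+1 ^ 2) = z ^+ (h ^ 2).
  have -> : (h.+1 ^ 2 = N + h ^ 2)%N by rewrite Nh; lia.
  by rewrite exprD (prim_expr_order zP) mul1r.
have -> : z ^+ (h ^ 2) = \prod_(i < h) z ^+ i.*2.+1.
  rewrite prodrXr; congr (_ ^+ _); elim: (h) => [|k IH]; first by rewrite big_ord0.
  by rewrite big_ord_recr/= -IH; lia.
rewrite -big_split/=; apply: eq_bigr => i _; rewrite mulrBr mulr1 qk; congr (_ - _).
have -> : (2 * i.*2.+1 = i.*2.+1 + i.*2.+1)%N by lia.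
by rewrite exprD invfM mulrA divff ?mul1r ?expf_neq0.
Qed.

(** Shifting [x] by [y] turns [z^(x^2 - y^2)] into [z^(x^2 + 2 x y)]; summing over [y] leaves only
    [x = 0], since [N] is odd. *)
Lemma gauss_sumV z : N.-primitive_root z -> gauss_sum z * gauss_sum z^-1 = N%:R.
Proof.
move=> zP; have z0 := prim_root_neq0 zP.
transitivity (\sum_(y < N) \sum_(x < N) z ^+ (x ^ 2) * (z ^+ (2 * x)) ^+ y).
  rewrite /gauss_sum mulr_sumr; apply: eq_bigr => y _; rewrite mulr_suml.
  rewrite -(@sum_periodic_shift _ (fun x => z ^+ (x ^ 2) * z^-1 ^+ (y ^ 2)) N y); last first.
    move=> x; have -> : ((x + N) ^ 2 = x ^ 2 + N * (2 * x + N))%N by lia.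
    by rewrite exprD exprM (prim_expr_order zP) expr1n mulr1.
  apply: eq_bigr => x _; have -> : ((x + y) ^ 2 = x ^ 2 + 2 * x * y + y ^ 2)%N by lia.
  rewrite (exprD _ (x ^ 2 + 2 * x * y)%N) (exprD _ (x ^ 2)%N) (exprM _ (2 * x)%N).
  by rewrite exprVn -mulrA divff ?mulr1 ?expf_neq0.
rewrite exchange_big/=; under eq_bigr => x _ do rewrite -mulr_sumr sum_prim_root//.
have N0 := prim_order_gt0 zP; rewrite (bigD1 (Ordinal N0))//= dvdn0 mul1r.
rewrite big1 ?addr0// => x x0; rewrite Gauss_dvdr ?coprimen2// gtnNdvd ?mulr0//.
by rewrite lt0n; apply: contraNneq x0 => x0; apply/eqP/val_inj.
Qed.

(** Each of the [N./2] factors in the product formula changes sign under [z -> z^-1]. *)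
Lemma gauss_sum_sqr z : N.-primitive_root z ->
  gauss_sum z ^+ 2 = (-1) ^+ N./2 * N%:R.
Proof.
move=> zP; rewrite -(gauss_sumV z)// mulrCA expr2; congr (_ * _).
have -> : (-1) ^+ N./2 = \prod_(i < N./2) (-1 : C) by rewrite prodr_const card_ord.
rewrite !gauss_sum_prod ?prim_rootV// -big_split/=.
by apply: eq_bigr => i _; rewrite mulN1r opprB exprVn invrK.
Qed.

End GaussProduct.

(** * Complex roots of unity and the sign of the Gauss sum *)

Section ComplexRoots.
Context {R : realType}.
Implicit Types (x : R) (N : nat).
Local Open Scope complex_scope.

Definition expi x : R[i] := cos x +i* sin x.

Lemma expiD x y : expi (x + y) = expi x * expi y.
Proof. by apply/eqP; rewrite eq_complex/= cosD sinD eqxx/= addrC eqxx. Qed.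

Lemma expi0 : expi 0 = 1.
Proof. by rewrite /expi cos0 sin0. Qed.

Lemma expiX x k : expi x ^+ k = expi (k%:R * x).
Proof.
elim: k => [|k IH]; first by rewrite mul0r expi0.
by rewrite exprS IH -expiD -natr1 mulrDl mul1r addrC.
Qed.

Lemma expi2pi k : expi (k%:R * (pi *+ 2)) = 1.
Proof. by rewrite -expiX /expi cos2pi sin2pi expr1n. Qed.

Lemma expiN x : expi (- x) = (expi x)^-1.
Proof.
have x1 : expi x * expi (- x) = 1 by rewrite -expiD subrr expi0.
have x0 : expi x != 0 by apply: contraTneq (oner_neq0 (R[i])) => x0; rewrite -x1 x0 mul0r eqxx.
by apply: (mulfI x0); rewrite x1 divff.
Qed.

Definition zeta N : R[i] := expi (pi *+ 2 / N%:R).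

Lemma zetaX N k : zeta N ^+ k = expi (pi *+ 2 * k%:R / N%:R).
Proof. by rewrite expiX mulrA [_ * (pi *+ 2)]mulrC. Qed.

Lemma zeta_prim_root N : (0 < N)%N -> N.-primitive_root (zeta N).
Proof.
move=> N0; have NR0 : (0 : R) < N%:R by rewrite ltr0n.
apply: prim_rootI => // [|i /andP[i0 iN]].
  by rewrite zetaX mulfK ?gt_eqF// -[_ *+ 2]mul1r (expi2pi 1).
rewrite zetaX eq_complex/= negb_and; apply/orP; left.
have -> : pi *+ 2 * i%:R / N%:R = (pi * i%:R / N%:R) *+ 2 :> R.
  by rewrite -!mulrnAl.
apply/eqP; rewrite cos_mulr2n => ca.
have : 0 < sin (pi * i%:R / N%:R : R).
  apply: sin_gt0_pi; rewrite -mulrA mulr_gt0 ?pi_gt0 ?divr_gt0 ?ltr0n//=.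
  by rewrite gtr_pMr ?pi_gt0// ltr_pdivrMr// mul1r ltr_nat.
by have := cos2Dsin2 (pi * i%:R / N%:R : R); nra.
Qed.

Lemma zeta_subV N k : zeta N ^+ k - zeta N ^- k =
  'i * (2 * sin (pi *+ 2 * k%:R / N%:R))%:C.
Proof.
rewrite zetaX -expiN; apply/eqP; rewrite eq_complex/= cosN sinN.
by apply/andP; split; apply/eqP; ring.
Qed.

Lemma sum_lt_odd h n : (\sum_(i < n) (h < i.*2.+1) = n - uphalf h)%N.
Proof.
elim: n => [|n IH]; first by rewrite big_ord0.
by rewrite big_ord_recr/= IH; case: ltnP => /=; lia.
Qed.

(** The sine of index [i] is negative exactly when its angle exceeds [pi], that is when
    [h < 2 i + 1]; there are [h - uphalf h = h./2] such indices. *)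
Lemma prod_sin_sign h : exists2 r : R, 0 < r &
  \prod_(i < h) (2 * sin (pi *+ 2 * (i.*2.+1)%:R / (h.*2.+1)%:R)) = (-1) ^+ h./2 * r.
Proof.
pose s i : R := 2 * sin (pi *+ 2 * (i.*2.+1)%:R / (h.*2.+1)%:R).
have N0 : (0 : R) < h.*2.+1%:R by rewrite ltr0n.
have pi0 := pi_gt0 R.
have sE i : (i < h)%N -> 0 < (-1) ^+ (h < i.*2.+1)%N * s i.
  move=> ih; rewrite /s mulrCA mulr_gt0//.
  have -> : pi *+ 2 * (i.*2.+1)%:R / h.*2.+1%:R = pi * ((2 * i.*2.+1)%:R / h.*2.+1%:R) :> R.
    by rewrite natrM; ring.
  have u0 : (0 : R) < (2 * i.*2.+1)%:R / h.*2.+1%:R by rewrite divr_gt0// ltr0n.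
  have u2 : (2 * i.*2.+1)%:R / h.*2.+1%:R < 2 :> R.
    by rewrite ltr_pdivrMr// -natrM ltr_nat; lia.
  case: ltnP => hi/=.
    have u1 : 1 < (2 * i.*2.+1)%:R / h.*2.+1%:R :> R.
      by rewrite ltr_pdivlMr// mul1r ltr_nat; lia.
    rewrite expr1 mulN1r -[X in sin X](subrK pi) sinDpi opprK.
    apply: sin_gt0_pi; move: u0 u1 u2; move: (_ / _) => u *.
    by apply/andP; split; nra.
  have u1 : (2 * i.*2.+1)%:R / h.*2.+1%:R < 1 :> R.
    by rewrite ltr_pdivrMr// mul1r ltr_nat; lia.
  rewrite expr0 mul1r; apply: sin_gt0_pi; move: u0 u1; move: (_ / _) => u *.
  by apply/andP; split; nra.
exists (\prod_(i < h) ((-1) ^+ (h < i.*2.+1)%N * s i)).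
  by apply: prodr_gt0 => i _; exact: sE.
rewrite [in RHS]big_split/= prodrXr sum_lt_odd mulrA.
have -> : (h - uphalf h = h./2)%N by lia.
by rewrite -expr2 sqrr_sign mul1r.
Qed.

(** For odd [N] this is [1] when [N] is [1] modulo [4] and ['i] when [N] is [3] modulo [4]. *)
Definition gauss_unit N : R[i] := 'i ^+ odd N./2.

(** In the product formula ['i ^+ h] and the sign [(-1) ^+ h./2] of the sines combine to
    [gauss_unit N]; the remaining positive factor is fixed by the square of the sum. *)
Lemma gauss_sum_zeta N : odd N ->
  gauss_sum (N := N) (zeta N) = gauss_unit N * (Num.sqrt N%:R)%:C.
Proof.
move=> oddN; have zP := zeta_prim_root N (odd_gt0 oddN); set h := N./2.
have Nh : N = h.*2.+1 by rewrite /h; lia.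
have [r r0 rE] := prod_sin_sign h.
have iE : 'i ^+ 2 = -1 :> R[i] by rewrite sqr_i.
have GE : gauss_sum (N := N) (zeta N) = gauss_unit N * r%:C.
  rewrite gauss_sum_prod// -/h.
  pose s i : R := 2 * sin (pi *+ 2 * (i.*2.+1)%:R / (h.*2.+1)%:R).
  rewrite (eq_bigr (fun i : 'I_h => 'i * (s i)%:C)) => [|i _]; last first.
    by rewrite zeta_subV /s -Nh.
  rewrite big_split/= -rmorph_prod/= rE prodr_const card_ord /gauss_unit -/h.
  rewrite rmorphM rmorphXn rmorphN1 mulrA; congr (_ * _).
  rewrite -[in X in X * _](odd_double_half h) exprD -mul2n exprM iE -mulrA -expr2.
  by rewrite sqrr_sign mulr1.
have r2 : r ^+ 2 = N%:R.
  have := gauss_sum_sqr oddN (zeta N) zP; rewrite GE exprMn -/h /gauss_unit -/h -exprM mulnC exprM iE.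
  have N10 : (-1 : R[i]) != 0 by rewrite oppr_eq0 oner_neq0.
  rewrite signr_odd => /(mulfI (expf_neq0 h N10)) => E.
  by apply: (@complexI R); rewrite rmorphXn/= E rmorph_nat.
by rewrite GE -r2 sqrtr_sqr gtr0_norm.
Qed.

End ComplexRoots.

(** * Gauss sums twisted by the Legendre symbol *)

Section PrimeGaussSums.
Context {C : fieldType} {p : nat} (pP : prime p) (oddp : odd p).
Context {z : C} (zP : p.-primitive_root z).

Let psi (a : 'F_p) : C := z ^+ a.

Let psi_nat k : psi k%:R = z ^+ k.
Proof. by rewrite /psi val_Fp_nat// (prim_expr_mod zP). Qed.

Let sum_Fp (f : nat -> C) : \sum_(k < p) f k = \sum_(a : 'F_p) f a.
Proof.
have H n : p = n -> \sum_(k < p) f k = \sum_(k < n) f k by move=> <-.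
exact: H (esym (Fp_cast pP)).
Qed.

Let chi (a : 'F_p) : C := (quadchar 'F_p a)%:~R.

Let oddF : odd #|'F_p|. Proof. by rewrite card_Fp. Qed.

Let chiM a b : chi (a * b) = chi a * chi b.
Proof. by rewrite /chi (quadcharM oddF) rmorphM. Qed.

Let psiM (a : 'F_p) k : z ^+ (a * k) = psi (a * k%:R).
Proof. by rewrite -[a in RHS]natr_Zp -natrM psi_nat. Qed.

Let sum_psi : \sum_a psi a = 0.
Proof.
have := sum_prim_root z 1 zP; rewrite expr1 sum_Fp => ->.
by rewrite dvdn1 gtn_eqF ?prime_gt1.
Qed.

(** For [k] prime to [p], substitute [a -> a k] in the Gauss sum written with the character. For [p]
    dividing [k] both sides vanish, so the identity covers every [k]. *)
Lemma sum_legendre_root (k : nat) :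
  \sum_(x < p) (legendre x%:Z p)%:~R * z ^+ (x * k) =
  (legendre k%:Z p)%:~R * gauss_sum (N := p) z.
Proof.
rewrite (sum_Fp (fun x => (legendre x%:Z p)%:~R * z ^+ (x * k))).
rewrite /gauss_sum (sum_Fp (fun x => z ^+ (x ^ 2))) legendre_quadchar//.
transitivity (\sum_a chi a * psi (a * k%:R)).
  by apply: eq_bigr => a _; rewrite psiM legendre_quadchar// /chi -pmulrn natr_Zp.
rewrite -pmulrn -/(chi _).
have -> : \sum_(a : 'F_p) z ^+ (a ^ 2) = \sum_a chi a * psi a.
  transitivity (\sum_a psi (a ^+ 2)).
    by apply: eq_bigr => a _; rewrite -mulnn psiM natr_Zp.
  exact: (sum_sqr_quadchar0 oddF psi sum_psi).
have [->|k0] := eqVneq (k%:R : 'F_p) 0.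
  rewrite [chi 0]/chi quadchar0 mul0r.
  under eq_bigr => a _ do rewrite mulr0 /psi expr0 mulr1.
  exact: (@sum_quadchar _ oddF C).
have kk : chi k%:R * chi k%:R = 1 by rewrite /chi -rmorphM/= quadchar_mulr_self.
rewrite [in RHS](reindex_inj (mulIf k0))/= mulr_sumr; apply: eq_bigr => a _.
by rewrite chiM [chi a * chi _]mulrC !mulrA kk mul1r.
Qed.

(** The source of the Legendre symbols in reciprocity: the factors of a Gauss sum modulo [p q] are
    Gauss sums at powers of the standard roots. *)
Lemma gauss_sumX (k : nat) : ~~ (p %| k)%N ->
  \sum_(x < p) (z ^+ k) ^+ (x ^ 2) = (legendre k%:Z p)%:~R * gauss_sum (N := p) z.
Proof.
move=> pk; rewrite -sum_legendre_root.
rewrite (sum_Fp (fun x => (legendre x%:Z p)%:~R * z ^+ (x * k))).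
rewrite (sum_Fp (fun x => (z ^+ k) ^+ (x ^ 2))).
transitivity (\sum_(a : 'F_p) psi (a ^+ 2 * k%:R)).
  apply: eq_bigr => a _.
  have -> : a ^+ 2 * k%:R = (a * a * k)%:R by rewrite !natrM natr_Zp expr2.
  by rewrite psi_nat -exprM mulnC mulnn.
have k0 : (k%:R : 'F_p) != 0 by rewrite -(dvdn_pcharf (pchar_Fp pP)).
have psik : \sum_a psi (a * k%:R) = 0 by rewrite -[RHS]sum_psi [in RHS](reindex_inj (mulIf k0)).
etransitivity; first exact: (sum_sqr_quadchar0 oddF (fun a => psi (a * k%:R)) psik).
by apply: eq_bigr => a _; rewrite psiM legendre_quadchar// -pmulrn natr_Zp.
Qed.

End PrimeGaussSums.

(** * Quadratic reciprocity *)

Section Reciprocity.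
Context {R : realType}.
Local Open Scope complex_scope.

Lemma zetaXl m n : (0 < m)%N -> zeta (m * n)%N ^+ m = zeta n :> R[i].
Proof.
move=> m0; rewrite zetaX /zeta natrM; congr expi.
by rewrite invfM mulrA mulfK// pnatr_eq0 -lt0n.
Qed.

Lemma zetaXr m n : (0 < n)%N -> zeta (m * n)%N ^+ n = zeta m :> R[i].
Proof. by rewrite mulnC; exact: zetaXl. Qed.

(** The cross term of [(a n + b m)^2] is a multiple of [m n], so the exponential splits along the
    Chinese remainder decomposition. *)
Lemma gauss_sumM m n : (0 < m)%N -> (0 < n)%N -> coprime m n ->
  gauss_sum (N := (m * n)%N) (zeta (m * n)%N : R[i]) =
  (\sum_(a < m) (zeta m ^+ n) ^+ (a ^ 2)) * (\sum_(b < n) (zeta n ^+ m) ^+ (b ^ 2)).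
Proof.
move=> m0 n0 mn; have mn0 : (0 < m * n)%N by rewrite muln_gt0 m0.
have zP := zeta_prim_root (R := R) (m * n)%N mn0.
rewrite /gauss_sum (sum_crt (fun x => zeta (m * n)%N ^+ (x ^ 2))) => // [|x]; last first.
  by rewrite -(prim_expr_mod zP) modnXm (prim_expr_mod zP).
rewrite mulr_suml; apply: eq_bigr => -[a /= _] _; rewrite mulr_sumr.
apply: eq_bigr => -[b /= _] _.
have -> : ((a * n + b * m) ^ 2 = n * (n * a ^ 2) + m * (m * b ^ 2) + (m * n) * (2 * a * b))%N.
  by lia.
rewrite exprD [X in _ * X]exprM (prim_expr_order zP) expr1n mulr1 exprD.
by rewrite (exprM _ n) (exprM _ m) zetaXr// zetaXl// !exprM.
Qed.

Lemma sqrtC_natM m n : (Num.sqrt (m * n)%N%:R)%:C =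
  (Num.sqrt m%:R)%:C * (Num.sqrt n%:R)%:C :> R[i].
Proof. by rewrite natrM sqrtrM ?ler0n// rmorphM. Qed.

Lemma sqrtC_nat_neq0 n : (0 < n)%N -> (Num.sqrt n%:R)%:C != 0 :> R[i].
Proof. by move=> n0; rewrite fmorph_eq0 sqrtr_eq0 -ltNge ltr0n. Qed.

(** Only the case of [m] and [n] both [3] modulo [4] gives a sign, ['i * 'i = -1]: this is the sign
    of the reciprocity law. *)
Lemma gauss_unitM m n : odd m -> odd n ->
  gauss_unit m * gauss_unit n = (-1) ^+ (m./2 * n./2) * gauss_unit (m * n) :> R[i].
Proof.
move=> om on; rewrite /gauss_unit odd_halfM// -[in RHS]signr_odd oddM.
case: (odd m./2); case: (odd n./2); rewrite /= ?expr0 ?expr1 ?mul1r ?mulr1//.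
by rewrite -expr2 sqr_i.
Qed.

Lemma gauss_unit_neq0 n : gauss_unit n != 0 :> R[i].
Proof.
by rewrite /gauss_unit expf_neq0// eq_complex/= oner_eq0 andbF.
Qed.

End Reciprocity.

(* [R] plays no role in the statement: it carries the Gauss sums of the proof. *)
Lemma legendre_reciprocity {R : realType} p q :
  prime p -> prime q -> odd p -> odd q -> p != q ->
  legendre p%:Z q * legendre q%:Z p = (-1) ^+ (p./2 * q./2).
Proof.
move=> pP qP op oq pq.
have [p0 q0] := (prime_gt0 pP, prime_gt0 qP).
have cpq : coprime p q by rewrite prime_coprime// dvdn_prime2.
have opq : odd (p * q) by rewrite oddM op.
(* Evaluating the Gauss sum modulo [p q] directly and through its two factors compares
   [gauss_unit (p * q)] with [gauss_unit p * gauss_unit q] times the two symbols. *)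
have := gauss_sumM (R := R) p q p0 q0 cpq.
rewrite (gauss_sumX pP op (zeta_prim_root p p0)); last by rewrite -prime_coprime.
rewrite (gauss_sumX qP oq (zeta_prim_root q q0)); last first.
  by rewrite -prime_coprime// coprime_sym.
rewrite !gauss_sum_zeta// sqrtC_natM => E.
have nz := mulf_neq0 (gauss_unit_neq0 (R := R) (p * q))
  (mulf_neq0 (sqrtC_nat_neq0 (R := R) p p0) (sqrtC_nat_neq0 q q0)).
apply: (@intr_inj R[i]); rewrite intrM rmorph_sign.
have ss := sqrr_sign R[i] (p./2 * q./2).
have := gauss_unitM (R := R) p q op oq; move: ss E nz.
move: ((-1) ^+ _) ((legendre p%:Z q)%:~R) ((legendre q%:Z p)%:~R) => s L L' ss E nz gM.
have {}E : 1 = L * L' * s.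
  apply: (mulIf nz); rewrite mul1r.
  transitivity (L * L' * (s * gauss_unit (p * q)) * ((Num.sqrt p%:R)%:C * (Num.sqrt q%:R)%:C))%C.
    by rewrite E -gM; ring.
  by ring.
by rewrite -[LHS]mulr1 -ss expr2 mulrA -E mul1r.
Qed.

(** Both sides are multiplicative in [a] and in [b], which reduces to two primes by induction on
    each; for equal primes both symbols are [0]. *)
Lemma jacobi_reciprocity {R : realType} a b : odd a -> odd b ->
  jacobi a%:Z b = (-1) ^+ (a./2 * b./2) * jacobi b%:Z a.
Proof.
move=> oa ob; move: a oa; apply: odd_prime_ind => [|p a pP op oa IH].
  by rewrite jacobi1r mulr1 mul0n jacobi1l.
have p0 := prime_gt0 pP.
rewrite PoszM jacobiMl// jacobiMr ?p0 ?odd_gt0// IH (jacobi_prime _ _ pP).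
suff -> : jacobi p%:Z b = (-1) ^+ (p./2 * b./2) * legendre b%:Z p.
  rewrite mulrACA -exprD; congr (_ * _).
  rewrite -[LHS]signr_odd -[RHS]signr_odd; congr (_ ^+ nat_of_bool _).
  by rewrite oddD !oddM odd_halfM// andb_addl.
move: b ob {a oa IH}; apply: odd_prime_ind => [|q b qP oq ob IH].
  by rewrite jacobi1r muln0 mul1r legendre1.
rewrite PoszM (legendreM pP op) jacobiMr ?(prime_gt0 qP) ?(odd_gt0 ob)// IH (jacobi_prime _ _ qP).
suff -> : legendre p%:Z q = (-1) ^+ (p./2 * q./2) * legendre q%:Z p.
  rewrite mulrACA -exprD; congr (_ * _).
  rewrite -[LHS]signr_odd -[RHS]signr_odd; congr (_ ^+ nat_of_bool _).
  by rewrite oddD !oddM odd_halfM// andb_addr.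
have [->|pq] := eqVneq p q; first by rewrite /legendre dvdzz mulr0.
have qq : legendre q%:Z p * legendre q%:Z p = 1.
  by rewrite (legendre_mul_self pP op)// dvdzE/= dvdn_prime2.
by rewrite -(legendre_reciprocity (R := R))// -mulrA qq mulr1.
Qed.

(** * Gauss sums of Jacobi symbols *)

Lemma square_free_dvd d m : (d %| m)%N -> square_free m -> square_free d.
Proof. by move=> dm mS e ed; apply: mS; exact: dvdn_trans ed dm. Qed.

Lemma square_free_prime_coprime p n : prime p -> square_free (p * n) -> coprime p n.
Proof.
move=> pP pnS; rewrite prime_coprime//; apply/negP => pn.
have : p = 1%N by apply: pnS; rewrite -mulnn dvdn_mul.
by move=> p1; rewrite p1 in pP.
Qed.

Section JacobiGaussSum.
Context {R : realType}.
Local Open Scope complex_scope.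

(** One prime is split off at a time, and square-freeness makes it coprime to the rest. The cross
    symbols [(n/p) (p/n)] amount to the reciprocity sign, which cancels the sign of [gauss_unitM].
    All [l] are covered, including those sharing a factor with [m]. *)
Lemma gauss_sum_jacobi m : odd m -> square_free m -> forall l : nat,
  \sum_(k < m) (jacobi k%:Z m)%:~R * zeta m ^+ (k * l) =
  (jacobi l%:Z m)%:~R * (gauss_unit m * (Num.sqrt m%:R)%:C) :> R[i].
Proof.
move: m; apply: odd_prime_ind => [_ l|p n pP op on IH pnS l].
  by rewrite big_ord1 !jacobi1r mul0n expr0 /gauss_unit expr0 sqrtr1 !mulr1.
have [p0 n0] := (prime_gt0 pP, odd_gt0 on).
have cpn := square_free_prime_coprime p n pP pnS.
have {}IH := IH (square_free_dvd _ _ (dvdn_mull _ (dvdnn n)) pnS) l.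
have opn : odd (p * n) by rewrite oddM op.
have pn0 : (0 < p * n)%N by rewrite muln_gt0 p0.
rewrite (sum_crt (fun k => (jacobi k%:Z (p * n))%:~R * zeta (p * n)%N ^+ (k * l))) => // [|k]; last first.
  congr (_%:~R * _).
    by apply: jacobi_modz => //; rewrite -modz_nat modz_mod.
  have zP := zeta_prim_root (R := R) (p * n)%N pn0.
  by rewrite -(prim_expr_mod zP) modnMml (prim_expr_mod zP).
have E a b : (jacobi (a * n + b * p)%N%:Z (p * n))%:~R * zeta (p * n)%N ^+ ((a * n + b * p) * l) =
    (jacobi n%:Z p * jacobi p%:Z n)%:~R * (((legendre a%:Z p)%:~R * zeta p ^+ (a * l)) *
     ((jacobi b%:Z n)%:~R * zeta n ^+ (b * l))) :> R[i].
  have -> : jacobi (a * n + b * p)%N%:Z (p * n) =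
      jacobi n%:Z p * jacobi p%:Z n * (legendre a%:Z p * jacobi b%:Z n).
    rewrite jacobiMr//.
    have -> : jacobi (a * n + b * p)%N%:Z p = jacobi (a%:Z * n%:Z) p.
      by apply: jacobi_modz => //; rewrite PoszD !PoszM addrC modzMDl.
    have -> : jacobi (a * n + b * p)%N%:Z n = jacobi (b%:Z * p%:Z) n.
      by apply: jacobi_modz => //; rewrite PoszD !PoszM modzMDl.
    by rewrite !jacobiMl// (jacobi_prime a%:Z _ pP); ring.
  have -> : ((a * n + b * p) * l = n * (a * l) + p * (b * l))%N by lia.
  rewrite exprD (exprM _ n) (exprM _ p) zetaXr// zetaXl// !intrM.
  by ring.
under eq_bigr => a _ do under eq_bigr => b _ do rewrite E.
under eq_bigr => a _ do rewrite -mulr_sumr -mulr_sumr IH.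
rewrite -mulr_sumr -mulr_suml sum_legendre_root//; last exact: zeta_prim_root.
rewrite gauss_sum_zeta// sqrtC_natM jacobiMr// (jacobi_prime l%:Z _ pP) intrM.
have s1 : (-1) ^+ (p./2 * n./2) * (jacobi n%:Z p * jacobi p%:Z n)%:~R = 1 :> R[i].
  rewrite (jacobi_reciprocity (R := R) p n)// mulrCA intrM rmorph_sign mulrA -expr2 sqrr_sign mul1r.
  rewrite (jacobi_prime _ _ pP) legendre_mul_self//.
  by rewrite dvdzE/= -prime_coprime.
rewrite -[RHS]mul1r -[X in _ = X * _]s1.
transitivity ((jacobi n%:Z p * jacobi p%:Z n)%:~R * ((legendre l p)%:~R * (jacobi l n)%:~R) *
  (gauss_unit p * gauss_unit n) * ((Num.sqrt p%:R)%:C * (Num.sqrt n%:R)%:C) : R[i]).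
  by ring.
by rewrite gauss_unitM//; ring.
Qed.

Lemma intC c : c%:~R = (c%:~R : R)%:C :> R[i].
Proof. exact: esym (rmorph_int (real_complex R) c). Qed.

Lemma sum_jacobi_sin m (l : nat) : odd m -> odd m./2 -> square_free m ->
  \sum_(k < m) (jacobi k%:Z m)%:~R * sin (pi *+ 2 * (k * l)%:R / m%:R) =
  (jacobi l%:Z m)%:~R * Num.sqrt m%:R :> R.
Proof.
move=> om om2 mS; have := gauss_sum_jacobi m om mS l.
rewrite /gauss_unit om2 expr1 => /(congr1 (@complex.Im R)).
rewrite raddf_sum/= => E.
transitivity (complex.Im ((jacobi l m)%:~R * ('i * (Num.sqrt m%:R)%:C) : R[i])).
  rewrite -E; apply: eq_bigr => k _; rewrite zetaX.
  by rewrite intC/= mul0r addr0.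
by rewrite intC/=; ring.
Qed.

End JacobiGaussSum.

Lemma sum_ord_pair {V : nmodType} (G : nat -> V) n :
  \sum_(k < n + n) G k = \sum_(k < n) (G k + G (n + (n - k.+1))%N).
Proof.
rewrite big_split_ord big_split/=; congr (_ + _).
by rewrite (reindex_inj rev_ord_inj).
Qed.

Lemma half_sum_jacobi_sin {R : realType} (m t l : nat) : m = (4 * t + 3)%N -> square_free m ->
  2 * \sum_(k < (2 * t).+1) (jacobi k.+1%:Z m)%:~R * sin (pi *+ 2 * (k.+1 * l)%:R / m%:R) =
  (jacobi l%:Z m)%:~R * Num.sqrt m%:R :> R.
Proof.
move=> mt mS; have om : odd m by lia.
have om2 : odd m./2 by lia.
rewrite -sum_jacobi_sin//.
pose F k : R := (jacobi k%:Z m)%:~R * sin (pi *+ 2 * (k * l)%:R / m%:R).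
(* The term [k = 0] vanishes and the other [m - 1 = 2 (2 t + 1)] terms pair as [k] and [m - k];
   symbol and sine both change sign, so paired terms agree. *)
transitivity (\sum_(k < ((2 * t).+1 + (2 * t).+1).+1) F k); last first.
  by have -> : ((2 * t).+1 + (2 * t).+1).+1 = m by lia.
have F0 : F 0%N = 0 by rewrite /F mul0n mulr0 mul0r sin0 mulr0.
rewrite [RHS]big_ord_recl/= F0 add0r.
rewrite (sum_ord_pair (fun k => F k.+1)) mulr_sumr; apply: eq_bigr => k _.
have kt := ltn_ord k.
suff -> : F ((2 * t).+1 + ((2 * t).+1 - k.+1)).+1 = F k.+1 by rewrite -mulr2n mulr_natl.
have -> : ((2 * t).+1 + ((2 * t).+1 - k.+1)).+1 = (m - k.+1)%N by lia.
have km : (k.+1 <= m)%N by lia.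
rewrite /F.
have -> : jacobi (m - k.+1)%N%:Z m = - jacobi k.+1%:Z m.
  have -> : jacobi (m - k.+1)%N%:Z m = jacobi (-1 * k.+1%:Z) m.
    apply: jacobi_modz => //; rewrite -subzn// mulN1r addrC.
    by rewrite modzDr.
  by rewrite jacobiMl// jacobiN1// -signr_odd om2 expr1 mulN1r.
have -> : pi *+ 2 * ((m - k.+1) * l)%:R / m%:R = - (pi *+ 2 * (k.+1 * l)%:R / m%:R) + pi *+ 2 *+ l :> R.
  have m0 : m%:R != 0 :> R by rewrite pnatr_eq0; lia.
  by rewrite !natrM natrB// -[pi *+ 2 *+ l]mulr_natr; field.
by rewrite (periodicn (@sinD2pi R)) sinN rmorphN mulrNN.
Qed.

(** * Dirichlet-type estimates *)

Section RealDerivatives.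
Context {R : realType}.
Implicit Types (f g : R -> R) (x a b : R).

Lemma is_derive_mul f g x a b : is_derive x 1 f a -> is_derive x 1 g b ->
  is_derive x 1 (fun y => f y * g y) (a * g x + f x * b).
Proof.
move=> fa gb; apply: is_derive_eq (is_deriveM fa gb) _.
by rewrite addrC [a * _]mulrC.
Qed.

Lemma is_derive_inv f x a : f x != 0 -> is_derive x 1 f a ->
  is_derive x 1 (fun y => (f y)^-1) (- a / f x ^+ 2).
Proof.
move=> fx0 fa; apply: is_derive_eq (is_deriveV fx0 fa) _.
by rewrite -[_ *: _]/(_ * _) mulrC mulrN mulNr.
Qed.

Lemma is_derive_bigsum (F : nat -> R -> R) (dF : nat -> R) N x :
  (forall j, is_derive x 1 (F j) (dF j)) ->
  is_derive x 1 (fun y => \sum_(j < N) F j y) (\sum_(j < N) dF j).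
Proof.
move=> FD; have := is_derive_sum (fun j : 'I_N => FD j).
by rewrite fct_sumE.
Qed.

Lemma is_derive_const (c x : R) : is_derive x 1 (fun=> c) 0.
Proof. exact: is_derive_cst. Qed.

Lemma is_derive_scale a x : is_derive x 1 (fun y => a * y) a.
Proof.
apply: is_derive_eq (is_derive_mul _ _ _ _ _ (is_derive_const a x) (is_derive_id x 1)) _.
by rewrite mul0r add0r mulr1.
Qed.

Lemma is_derive_sin_scale a x : is_derive x 1 (fun y => sin (a * y)) (a * cos (a * x)).
Proof. by rewrite mulrC; exact: is_derive1_comp (is_derive_sin (a * x)) (is_derive_scale a x). Qed.

Lemma is_derive_cos_scale a x : is_derive x 1 (fun y => cos (a * y)) (- (a * sin (a * x))).
Proof.
by rewrite mulrC -mulNr; exact: is_derive1_comp (is_derive_cos (a * x)) (is_derive_scale a x).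
Qed.

Lemma is_derive_expr n x : is_derive x 1 (fun y => y ^+ n.+1) (n.+1%:R * x ^+ n).
Proof.
elim: n => [|n IH].
  by rewrite mulr1; apply: is_derive_eq (is_derive_id x 1) _.
under eq_fun => y do rewrite exprS.
apply: is_derive_eq (is_derive_mul _ _ _ _ _ (is_derive_id x 1) IH) _.
by rewrite mul1r mulrCA -exprS -[n.+2%:R]natr1 mulrDl mul1r addrC.
Qed.

Lemma MVT_eq (F dF : R -> R) a b : a <= b ->
  (forall x, a <= x <= b -> is_derive x 1 F (dF x)) ->
  exists2 c, a <= c <= b & F b - F a = dF c * (b - a).
Proof.
move=> ab FD; have [x|| c] := @MVT_segment R F dF a b ab.
- by rewrite in_itv/= => /andP[/ltW ? /ltW ?]; apply: FD; apply/andP.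
- apply: derivable_within_continuous => x; rewrite in_itv/= => xab.
  by have := FD x xab; case.
by rewrite in_itv/= => cab ->; exists c.
Qed.

Lemma MVT_le (F dF : R -> R) a b B : a <= b ->
  (forall x, a <= x <= b -> is_derive x 1 F (dF x)) ->
  (forall x, a <= x <= b -> `|dF x| <= B) ->
  `|F b - F a| <= B * (b - a).
Proof.
move=> ab FD dB; have [c cab ->] := MVT_eq F dF a b ab FD.
rewrite normrM [`|b - a|]ger0_norm ?subr_ge0//.
by rewrite ler_wpM2r ?subr_ge0// dB.
Qed.

Lemma le_abs_sin x : `|sin x| <= `|x|.
Proof.
wlog x0 : x / 0 <= x => [H|].
  have [/H//|/ltW x0] := leP 0 x.
  by rewrite -normrN -sinN -[in X in _ <= X]normrN; apply: H; rewrite oppr_ge0.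
have := MVT_le sin cos 0 x 1 x0 (fun y _ => is_derive_sin y) (fun y _ => cos_max y).
by rewrite sin0 !subr0 mul1r [`|x|]ger0_norm.
Qed.

Lemma dist_cos_1 x : `|cos x - 1| <= `|x|.
Proof.
wlog x0 : x / 0 <= x => [H|].
  have [/H//|/ltW x0] := leP 0 x.
  by rewrite -cosN -[in X in _ <= X]normrN; apply: H; rewrite oppr_ge0.
have := MVT_le cos (fun y => - sin y) 0 x 1 x0 (fun y _ => is_derive_cos y).
rewrite cos0 subr0 mul1r [`|x|]ger0_norm//; apply => y _.
by rewrite normrN sin_max.
Qed.

Lemma cvg_dist_le (u v : nat -> R) l :
  (forall n, `|u n - l| <= v n) -> v @ \oo --> 0 -> u @ \oo --> l.
Proof.
move=> uv v0; apply: (@squeeze_cvgr _ _ _ _ (fun n => l - v n) (fun n => l + v n)).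
- by apply: nearW => n; rewrite -ler_distl uv.
- by rewrite -[l in X in _ --> X]subr0; apply: cvgB => //; exact: cvg_cst.
- by rewrite -[l in X in _ --> X]addr0; apply: cvgD => //; exact: cvg_cst.
Qed.

Lemma cvg_dist_le_harmonic (u : nat -> R) l D :
  (forall n, `|u n.+1 - l| <= D * harmonic n) -> u @ \oo --> l.
Proof.
move=> uD; rewrite -cvg_shiftS; apply: cvg_dist_le uD _.
by rewrite -(mulr0 D); apply: cvgM (cvg_cst D) cvg_harmonic.
Qed.

Definition cos_sum N x : R := \sum_(j < N) cos (j.*2.+1%:R * x).

Lemma cos_sumE N x : 2 * sin x * cos_sum N x = sin ((2 * N)%:R * x).
Proof.
rewrite /cos_sum; elim: N => [|N IH]; first by rewrite big_ord0 mulr0 muln0 mul0r sin0.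
rewrite big_ord_recr/= mulrDr IH.
have N1 : N.*2.+1%:R = (2 * N)%:R + 1 :> R by rewrite natr1 mul2n.
have -> : (2 * N)%:R * x = N.*2.+1%:R * x - x by rewrite N1; ring.
have -> : (2 * N.+1)%:R * x = N.*2.+1%:R * x + x by rewrite N1 mulnS natrD; ring.
by rewrite sinB sinD; ring.
Qed.

(* Integration by parts: [cos_sum N x = sin (2 N x) / (2 sin x)] oscillates, so
   correcting [F N] by [cos (2 N x) h x / (2 N)] leaves a derivative of order [1/N]. *)
Lemma osc_cvg (F : nat -> R -> R) (g dg : R -> R) a b :
  (forall N x, 0 < x < pi -> is_derive x 1 (F N) (cos_sum N x * g x)) ->
  (forall x, is_derive x 1 g (dg x)) ->
  (forall x, `|g x| <= 1) -> (forall x, `|dg x| <= 1) ->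
  0 < a < pi -> 0 < b < pi -> (fun N => F N b - F N a) @ \oo --> 0.
Proof.
move=> FD gD g1 dg1 api bpi; wlog ab : a b api bpi / a <= b => [H|].
  have [/H|/ltW/H H'] := leP a b; first by apply.
  rewrite -oppr0; under eq_fun => N do rewrite -opprB.
  by apply: cvgN; exact: H'.
(* The minimum [s] of [sin] on [[a, b]] is positive and bounds the quotient [h] and its
   derivative. *)
have [c cab sinc] : exists2 c, c \in `[a, b] & forall x, x \in `[a, b] -> sin c <= sin x.
  by apply: EVT_min => //; apply: continuous_subspaceT; exact: continuous_sin.
have inpi x : a <= x <= b -> 0 < x < pi.
  move=> /andP[ax xb]; case/andP: api => a0 _; case/andP: bpi => _ bpi.
  by rewrite (lt_le_trans a0)// (le_lt_trans xb).
set s := sin c in sinc.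
have s0 : 0 < s by apply: sin_gt0_pi; apply: inpi; move: cab; rewrite in_itv.
have ss x : a <= x <= b -> s <= sin x by move=> xab; apply: sinc; rewrite in_itv.
have sinN0 x : a <= x <= b -> sin x != 0.
  by move=> /ss; apply: contraTneq => ->; rewrite -ltNge.
pose h x := g x / (2 * sin x).
pose dh x := (dg x * sin x - g x * cos x) / (2 * sin x ^+ 2).
have hD x : a <= x <= b -> is_derive x 1 h (dh x).
  move=> xab; have sx0 := sinN0 x xab.
  have sD : is_derive x 1 (fun y => 2 * sin y) (2 * cos x).
    have := is_derive_mul (fun=> 2) sin x 0 (cos x) (is_derive_const 2 x) (is_derive_sin x).
    by rewrite mul0r add0r.
  have s2 : 2 * sin x != 0 by rewrite mulf_neq0.
  have D := is_derive_inv (fun y => 2 * sin y) x _ s2 sD.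
  have {}D := is_derive_mul g _ x _ _ (gD x) D.
  apply: is_derive_eq D _.
  by rewrite /dh; field.
have h_le x : a <= x <= b -> `|h x| <= s^-1.
  move=> xab; have sx := ss x xab; rewrite normrM -[X in _ <= X]mul1r ler_pM//.
  rewrite normfV lef_pV2 ?posrE ?normr_gt0 ?mulf_neq0 ?sinN0//.
  by rewrite ger0_norm; lra.
have dh_le x : a <= x <= b -> `|dh x| <= s^-1 ^+ 2.
  move=> xab; have sx := ss x xab; have sx0 := lt_le_trans s0 sx.
  rewrite /dh normrM normfV [`|2 * _|]gtr0_norm ?mulr_gt0 ?exprn_gt0//.
  rewrite ler_pdivrMr ?mulr_gt0 ?exprn_gt0//.
  have n2 : `|dg x * sin x - g x * cos x| <= 2.
    apply: le_trans (ler_normB _ _) _; rewrite !normrM -[X in _ <= X]/(1 + 1).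
    by apply: lerD; rewrite mulr_ile1 ?sin_max ?cos_max.
  apply: le_trans n2 _; rewrite mulrCA ler_peMr// exprVn mulrC ler_pdivlMr ?exprn_gt0// mul1r.
  by nra.
apply: (@cvg_dist_le_harmonic _ _ (s^-1 ^+ 2 * (b - a) + 2 * s^-1)) => n.
rewrite subr0; set N := n.+1.
have N0 : (0 : R) < (2 * N)%:R by rewrite ltr0n.
pose G x := F N x + cos ((2 * N)%:R * x) * h x / (2 * N)%:R.
have GD x : a <= x <= b -> is_derive x 1 G (cos ((2 * N)%:R * x) * dh x / (2 * N)%:R).
  move=> xab; have sx0 := sinN0 x xab; have xpi := inpi x xab.
  have D1 := is_derive_mul _ h x _ _ (is_derive_cos_scale (2 * N)%:R x) (hD x xab).
  have D2 := is_derive_mul _ _ x _ _ D1 (is_derive_const (2 * N)%:R^-1 x).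
  apply: is_derive_eq (is_deriveD (FD N x xpi) D2) _.
  rewrite -cos_sumE /h; move: (cos _) (cos_sum _ _) (dh x) => u v w.
  by field; rewrite sx0 gt_eqF.
have dG x : a <= x <= b -> `|cos ((2 * N)%:R * x) * dh x / (2 * N)%:R| <= s^-1 ^+ 2 / (2 * N)%:R.
  move=> xab; rewrite normrM normfV [`|(2 * N)%:R|]gtr0_norm// ler_wpM2r ?invr_ge0 ?(ltW N0)//.
  by rewrite normrM -[X in _ <= X]mul1r ler_pM// ?cos_max ?dh_le.
have := MVT_le G _ a b _ ab GD dG.
have [aa bb] : a <= a <= b /\ a <= b <= b by rewrite !lexx ab.
have Fd : F N b - F N a = (G b - G a) -
    (cos ((2 * N)%:R * b) * h b - cos ((2 * N)%:R * a) * h a) / (2 * N)%:R.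
  by rewrite /G; field; rewrite gt_eqF.
have hab : `|cos ((2 * N)%:R * b) * h b - cos ((2 * N)%:R * a) * h a| <= 2 * s^-1.
  have ch x : a <= x <= b -> `|cos ((2 * N)%:R * x) * h x| <= s^-1.
    by move=> xab; rewrite normrM -[X in _ <= X]mul1r ler_pM// ?cos_max ?h_le.
  have -> : 2 / s = s^-1 + s^-1 by rewrite mulrDl mul1r.
  by apply: le_trans (ler_normB _ _) _; exact: lerD (ch b bb) (ch a aa).
move=> Gab; rewrite Fd; apply: le_trans (ler_normB _ _) _.
rewrite [X in _ + X]normrM normfV [`|(2 * N)%:R|]gtr0_norm//.
have iN : (2 * N)%:R^-1 <= harmonic n :> R.
  by rewrite /harmonic lef_pV2 ?posrE ?ltr0n// ler_nat leq_pmull.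
apply: (@le_trans _ _ ((s^-1 ^+ 2 * (b - a) + 2 * s^-1) * (2 * N)%:R^-1)).
  rewrite mulrDl lerD//; last by rewrite ler_wpM2r// invr_ge0 (ltW N0).
  by rewrite mulrAC.
rewrite ler_wpM2l// addr_ge0 ?mulr_ge0 ?exprn_ge0 ?invr_ge0 ?subr_ge0// ltW//.
Qed.

End RealDerivatives.

(** * Trigonometric partial fractions *)

Section PartialFractions.
Context {R : realType}.
Implicit Types (w x y : R) (N j : nat).

Local Notation odd_num j := (j.*2.+1%:R : R).

Lemma odd_num_ge1 j : 1 <= odd_num j.
Proof. by rewrite ler1n. Qed.

(** The partial sum minus [atan] has as derivative the remainder of a geometric series, at most
    [x^(2N)] in absolute value, so the error at [1] is at most [1 / (2N + 1)]. *)
Lemma leibniz_pi4 :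
  (fun N => \sum_(j < N) (-1) ^+ j / odd_num j) @ \oo --> (pi / 4 : R).
Proof.
apply: (@cvg_dist_le_harmonic _ _ _ 1) => n; rewrite mul1r; set N := n.+1.
pose D x : R := \sum_(j < N) (-1) ^+ j / odd_num j * x ^+ j.*2.+1 - atan x.
pose dD x : R := - (- x ^+ 2) ^+ N / (1 + x ^+ 2).
have x2 x : 1 + x ^+ 2 != 0 by rewrite gt_eqF// ltr_wpDr ?sqr_ge0.
have DD x : is_derive x 1 D (dD x).
  have S : is_derive x 1 (fun y => \sum_(j < N) (-1) ^+ j / odd_num j * y ^+ j.*2.+1)
      (\sum_(j < N) (- x ^+ 2) ^+ j).
    apply: (is_derive_bigsum (fun j y => (-1) ^+ j / odd_num j * y ^+ j.*2.+1)) => j.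
    apply: is_derive_eq (is_derive_mul _ _ x _ _ (is_derive_const _ x) (is_derive_expr j.*2 x)) _.
    have := odd_num_ge1 j; move: (odd_num j) => l l1.
    rewrite mul0r add0r -mulrA mulKf; last by rewrite gt_eqF// (lt_le_trans ltr01).
    by rewrite [RHS]exprNn -exprM mul2n.
  apply: is_derive_eq (is_deriveB S (is_derive1_atan x)) _.
  have := subrX1 (- x ^+ 2) N; rewrite /dD; move: (\sum_(j < N) _) => s E.
  apply: (mulfI (x2 x)); rewrite mulrBr divff// mulrCA divff// mulr1.
  have -> : (1 + x ^+ 2) * s = - ((- x ^+ 2 - 1) * s) by ring.
  by rewrite -E; ring.
(* [D] is dominated by [x^(2n+3)/(2n+3)]: both [H 1] and [H (-1)] increase on [[0, 1]]. *)
pose H s x : R := x ^+ n.*2.+3 / n.*2.+3%:R + s * D x.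
have HD s x : is_derive x 1 (H s) (x ^+ n.*2.+2 + s * dD x).
  have E1 := is_derive_mul _ _ x _ _ (is_derive_expr n.*2.+2 x) (is_derive_const n.*2.+3%:R^-1 x).
  have E2 := is_derive_mul _ _ x _ _ (is_derive_const s x) (DD x).
  apply: is_derive_eq (is_deriveD E1 E2) _.
  by rewrite mulr0 addr0 mul0r add0r mulrAC divff ?mul1r// pnatr_eq0.
have H_mono s : `|s| <= 1 -> H s 0 <= H s 1.
  move=> s1; have [c _ E] := MVT_eq (H s) _ 0 1 ler01 (fun x _ => HD s x).
  rewrite -subr_ge0 E subr0 mulr1.
  have : `|s * dD c| <= c ^+ n.*2.+2.
    rewrite normrM; apply: (@le_trans _ _ (1 * `|dD c|)); first by rewrite ler_wpM2r.
    rewrite mul1r /dD normrM normrN normrX normrN normfV.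
    rewrite ger0_norm ?sqr_ge0// -exprM mul2n ger0_norm; last by rewrite addr_ge0 ?sqr_ge0.
    rewrite ler_pdivrMr ?ltr_wpDr ?sqr_ge0// ler_peMr ?lerDl ?sqr_ge0//.
    by rewrite -mul2n exprM exprn_ge0 ?sqr_ge0.
  by rewrite ler_norml => /andP[? _]; rewrite -lerBlDl sub0r.
have D0 : D 0 = 0.
  by rewrite /D atan0 subr0 big1// => j _; rewrite expr0n mulr0.
have D1 : D 1 = \sum_(j < N) (-1) ^+ j / odd_num j - pi / 4.
  by rewrite /D atan1; congr (_ - _); apply: eq_bigr => j _; rewrite expr1n mulr1.
rewrite -D1; have := H_mono 1; have := H_mono (-1).
rewrite normrN normr1 /H D0 !expr1n expr0n/= !mulr0 mul0r addr0 mul1r mulN1r.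
move=> /(_ (lexx _)) a1 /(_ (lexx _)) a2.
have h3 : n.*2.+3%:R^-1 <= n.+1%:R^-1 :> R.
  by rewrite lef_pV2 ?posrE ?ltr0n// ler_nat; lia.
rewrite ler_norml; move: a1 a2 h3; move: (_^-1) (_^-1) (D 1) => u v d *.
by apply/andP; split; lra.
Qed.

Lemma sum_inv_odd_sqr N : \sum_(j < N) (odd_num j ^+ 2)^-1 <= 2.
Proof.
(* The sharper bound telescopes: [1 / l^2 <= 2 / l - 2 / (l + 2)] for [l >= 1]. *)
suff : \sum_(j < N) (odd_num j ^+ 2)^-1 <= 2 - 2 / odd_num N.
  by move/le_trans; apply; rewrite gerBl divr_ge0.
elim: N => [|N IH]; first by rewrite big_ord0 divr1 subrr.
rewrite big_ord_recr/=; apply: le_trans (lerD IH (lexx _)) _.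
have -> : odd_num N.+1 = odd_num N + 2 by rewrite -natrD; congr _%:R; lia.
have := odd_num_ge1 N; move: (odd_num N) => l l1.
rewrite -subr_ge0.
have -> : 2 - 2 / (l + 2) - (2 - 2 / l + (l ^+ 2)^-1) = (3 * l - 2) / (l ^+ 2 * (l + 2)).
  by field; apply/andP; split; lra.
by rewrite divr_ge0//; [lra|rewrite mulr_ge0 ?sqr_ge0//; lra].
Qed.

Lemma odd_den_ge w j : `|w| <= 2^-1 ->
  odd_num j ^+ 2 * (3 / 4) <= odd_num j ^+ 2 - w ^+ 2.
Proof.
rewrite ler_norml => /andP[wl wr].
have := odd_num_ge1 j; move: (odd_num j) => l l1.
have l2 : 1 <= l ^+ 2 by nra.
have w2 : w ^+ 2 <= 1 / 4 by nra.
by lra.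
Qed.

Lemma odd_den_gt0 w j : `|w| <= 2^-1 -> 0 < odd_num j ^+ 2 - w ^+ 2.
Proof.
move=> w2; apply: lt_le_trans (odd_den_ge w j w2).
by rewrite mulr_gt0// exprn_gt0// (lt_le_trans ltr01)// odd_num_ge1.
Qed.

Lemma inv_odd_den_le w j : `|w| <= 2^-1 ->
  (odd_num j ^+ 2 - w ^+ 2)^-1 <= 4 / 3 * (odd_num j ^+ 2)^-1.
Proof.
move=> w2; have := odd_den_ge w j w2; have := odd_den_gt0 w j w2.
have := odd_num_ge1 j; move: (odd_num j) => l l1 d0 dl.
have l2 : 0 < l ^+ 2 by nra.
rewrite -[_^-1]mul1r ler_pdivrMr// mulrAC ler_pdivlMr// mul1r.
by lra.
Qed.

Lemma sum_inv_odd_den_le w N : `|w| <= 2^-1 ->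
  \sum_(j < N) (odd_num j ^+ 2 - w ^+ 2)^-1 <= 8 / 3.
Proof.
move=> w2; apply: (@le_trans _ _ (4 / 3 * \sum_(j < N) (odd_num j ^+ 2)^-1)).
  by rewrite mulr_sumr; apply: ler_sum => j _; exact: inv_odd_den_le.
by have := sum_inv_odd_sqr N; move: (\sum_(j < N) _) => s; lra.
Qed.

(** Partial sums of the Fourier series on [(0, pi)] of [pi/4] times
    [cos (w (pi/2 - x)) / cos (w pi/2)]; [qser] is the companion with [sin (w (pi/2 - x))] in the
    numerator. *)
Definition pser w N x : R :=
  \sum_(j < N) odd_num j * sin (odd_num j * x) / (odd_num j ^+ 2 - w ^+ 2).
Definition qser w N x : R :=
  \sum_(j < N) w * cos (odd_num j * x) / (odd_num j ^+ 2 - w ^+ 2).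

(** Splitting [l^2 / (l^2 - w^2) = 1 + w^2 / (l^2 - w^2)], the ones add up to the kernel
    [cos_sum]. *)
Lemma is_derive_pser w N x : `|w| <= 2^-1 ->
  is_derive x 1 (pser w N) (cos_sum N x + w * qser w N x).
Proof.
move=> w2; rewrite /cos_sum /qser mulr_sumr -big_split/=.
apply: (is_derive_bigsum (fun j y => odd_num j * sin (odd_num j * y) / (odd_num j ^+ 2 - w ^+ 2))
  (fun j => cos (odd_num j * x) + w * (w * cos (odd_num j * x) / (odd_num j ^+ 2 - w ^+ 2)))) => j.
have d0 := odd_den_gt0 w j w2.
have E1 := is_derive_mul _ _ x _ _ (is_derive_const (odd_num j) x) (is_derive_sin_scale (odd_num j) x).
have E2 := is_derive_mul _ _ x _ _ E1 (is_derive_const (odd_num j ^+ 2 - w ^+ 2)^-1 x).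
apply: is_derive_eq E2 _; move: (sin _) (cos _) d0 => s c.
by move: (odd_num j) => l d0; field; rewrite gt_eqF.
Qed.

Lemma is_derive_qser w N x : is_derive x 1 (qser w N) (- (w * pser w N x)).
Proof.
rewrite /pser mulr_sumr -sumrN.
apply: (is_derive_bigsum (fun j y => w * cos (odd_num j * y) / (odd_num j ^+ 2 - w ^+ 2))
  (fun j => - (w * (odd_num j * sin (odd_num j * x) / (odd_num j ^+ 2 - w ^+ 2))))) => j.
have E1 := is_derive_mul _ _ x _ _ (is_derive_const w x) (is_derive_cos_scale (odd_num j) x).
have E2 := is_derive_mul _ _ x _ _ E1 (is_derive_const (odd_num j ^+ 2 - w ^+ 2)^-1 x).
apply: is_derive_eq E2 _; move: (sin _) (cos _) (_^-1) => s c d.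
by ring.
Qed.

(* The rotation that turns the nearly harmonic system [p' = K + w q], [q' = - w p]
   (with [K] the Dirichlet-type kernel [cos_sum]) into pure quadratures. *)
Definition xser w N x : R := pser w N x * cos (w * x) - qser w N x * sin (w * x).
Definition yser w N x : R := pser w N x * sin (w * x) + qser w N x * cos (w * x).

Lemma is_derive_xser w N x : `|w| <= 2^-1 ->
  is_derive x 1 (xser w N) (cos_sum N x * cos (w * x)).
Proof.
move=> w2.
have E1 := is_derive_mul _ _ x _ _ (is_derive_pser w N x w2) (is_derive_cos_scale w x).
have E2 := is_derive_mul _ _ x _ _ (is_derive_qser w N x) (is_derive_sin_scale w x).
apply: is_derive_eq (is_deriveB E1 E2) _.
move: (pser _ _ _) (qser _ _ _) (cos_sum _ _) => p q K.
by ring.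
Qed.

Lemma is_derive_yser w N x : `|w| <= 2^-1 ->
  is_derive x 1 (yser w N) (cos_sum N x * sin (w * x)).
Proof.
move=> w2.
have E1 := is_derive_mul _ _ x _ _ (is_derive_pser w N x w2) (is_derive_sin_scale w x).
have E2 := is_derive_mul _ _ x _ _ (is_derive_qser w N x) (is_derive_cos_scale w x).
apply: is_derive_eq (is_deriveD E1 E2) _.
move: (pser _ _ _) (qser _ _ _) (cos_sum _ _) => p q K.
by ring.
Qed.

Let norm_scale_le1 w (c : R) : `|w| <= 2^-1 -> `|c| <= 1 -> `|w * c| <= 1.
Proof.
move=> w2 c1; rewrite normrM mulr_ile1//; apply: le_trans w2 _.
by rewrite invf_le1// ler1n.
Qed.

Lemma xser_osc_cvg w x y : `|w| <= 2^-1 -> 0 < x < pi -> 0 < y < pi ->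
  (fun N => xser w N y - xser w N x) @ \oo --> 0.
Proof.
move=> w2; apply: (osc_cvg (xser w) (fun x => cos (w * x)) (fun x => - (w * sin (w * x)))).
- by move=> N z _; exact: is_derive_xser.
- by move=> z; exact: is_derive_cos_scale.
- by move=> z; exact: cos_max.
- by move=> z; rewrite normrN norm_scale_le1 ?sin_max.
Qed.

Lemma yser_osc_cvg w x y : `|w| <= 2^-1 -> 0 < x < pi -> 0 < y < pi ->
  (fun N => yser w N y - yser w N x) @ \oo --> 0.
Proof.
move=> w2; apply: (osc_cvg (yser w) (fun x => sin (w * x)) (fun x => w * cos (w * x))).
- by move=> N z _; exact: is_derive_yser.
- by move=> z; exact: is_derive_sin_scale.
- by move=> z; exact: sin_max.
- by move=> z; rewrite norm_scale_le1 ?cos_max.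
Qed.

End PartialFractions.

(** * Limits of the trigonometric series *)

Section Limits.
Context {R : realType}.
Implicit Types (w x y d : R) (N j : nat).
Local Notation odd_num j := (j.*2.+1%:R : R).

Lemma cvg_sub_cvg (u v : nat -> R) (l : R) :
  (fun n => u n - v n) @ \oo --> 0 -> v @ \oo --> l -> u @ \oo --> l.
Proof. exact: cvg_sub0. Qed.

Lemma odd_mul_pihalf j : odd_num j * (pi / 2) = pi / 2 + pi *+ j :> R.
Proof. by rewrite -natr1 -mul2n natrM -mulr_natr; field. Qed.

Lemma sin_odd_pihalf j : sin (odd_num j * (pi / 2)) = (-1) ^+ j :> R.
Proof. by rewrite odd_mul_pihalf (alternatingn (@sinDpi R)) sin_pihalf mulr1. Qed.

Lemma cos_odd_pihalf j : cos (odd_num j * (pi / 2)) = 0 :> R.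
Proof. by rewrite odd_mul_pihalf (alternatingn (@cosDpi R)) cos_pihalf mulr0. Qed.

Lemma pihalf_in : 0 < (pi / 2 : R) < pi.
Proof. by have := pi_gt0 R; move=> p0; apply/andP; split; lra. Qed.

(** At [w = 0] the rotation is trivial, so [pser 0] is asymptotically constant in [x]; at [pi / 2]
    it is the Leibniz series. *)
Lemma pser0_cvg x : 0 < x < pi -> (fun N => pser 0 N x) @ \oo --> pi / 4.
Proof.
move=> xpi.
have E N y : pser 0 N y = xser 0 N y.
  by rewrite /xser mul0r cos0 sin0 mulr1 mulr0 subr0.
have w0 : `|0 : R| <= 2^-1 by rewrite normr0 invr_ge0.
apply: (cvg_sub_cvg _ (fun N => pser 0 N (pi / 2))).
  under eq_fun => N do rewrite !E.
  exact: xser_osc_cvg pihalf_in xpi.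
apply: cvg_trans leibniz_pi4; apply: near_eq_cvg; apply: nearW => N.
apply: eq_bigr => j _; rewrite sin_odd_pihalf expr0n subr0 expr2.
have := odd_num_ge1 (R := R) j; move: (odd_num j) => l l1.
by field; rewrite gt_eqF// (lt_le_trans ltr01).
Qed.

Lemma norm_qser_le w N x : `|w| <= 2^-1 -> `|qser w N x| <= `|w| * (8 / 3).
Proof.
move=> w2; apply: le_trans (ler_norm_sum _ _ _) _.
apply: (@le_trans _ _ (`|w| * \sum_(j < N) (odd_num j ^+ 2 - w ^+ 2)^-1)).
  rewrite mulr_sumr; apply: ler_sum => j _.
  have d0 := odd_den_gt0 w j w2.
  rewrite !normrM normfV [`|_ - _|]gtr0_norm// ler_wpM2r ?invr_ge0 ?(ltW d0)//.
  by rewrite ler_piMr// cos_max.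
by rewrite ler_wpM2l// sum_inv_odd_den_le.
Qed.

(** The difference of the two fractions gains [w^2 / l^2], enough to absorb the coefficient [l] and
    the estimate [|sin (l x)| <= l |x|], uniformly in [N]. *)
Lemma norm_pserB_le w N x : `|w| <= 2^-1 ->
  `|pser w N x - pser 0 N x| <= w ^+ 2 * (8 / 3) * `|x|.
Proof.
move=> w2; rewrite /pser -sumrB; apply: le_trans (ler_norm_sum _ _ _) _.
apply: (@le_trans _ _ (w ^+ 2 * (\sum_(j < N) (odd_num j ^+ 2 - w ^+ 2)^-1) * `|x|)).
  rewrite mulr_sumr mulr_suml; apply: ler_sum => j _.
  have d0 := odd_den_gt0 w j w2; have l1 := odd_num_ge1 (R := R) j.
  have sl : `|sin (odd_num j * x)| <= odd_num j * `|x|.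
    by apply: le_trans (le_abs_sin _) _; rewrite normrM ger0_norm// (le_trans ler01).
  move: (odd_num j) d0 l1 sl => l d0 l1; move: (sin _) => s sl.
  have l0 : 0 < l by exact: lt_le_trans l1.
  have -> : l * s / (l ^+ 2 - w ^+ 2) - l * s / (l ^+ 2 - 0 ^+ 2) =
      w ^+ 2 / (l ^+ 2 - w ^+ 2) * (l^-1 * s).
    by field; rewrite !gt_eqF.
  have q0 : 0 <= w ^+ 2 / (l ^+ 2 - w ^+ 2) by apply: divr_ge0 (sqr_ge0 _) (ltW d0).
  rewrite normrM (ger0_norm q0) (ler_wpM2l q0)//.
  by rewrite normrM gtr0_norm ?invr_gt0// mulrC ler_pdivrMr// mulrC.
by rewrite ler_wpM2r// ler_wpM2l ?sqr_ge0// sum_inv_odd_den_le.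
Qed.

Lemma xser_near0 w N d : `|w| <= 2^-1 -> 0 <= d ->
  `|xser w N d - pser 0 N d * cos (w * d)| <= 2 * d.
Proof.
move=> w2 d0.
have -> : xser w N d - pser 0 N d * cos (w * d) =
  (pser w N d - pser 0 N d) * cos (w * d) - qser w N d * sin (w * d).
  by rewrite /xser; ring.
apply: le_trans (ler_normB _ _) _; rewrite !normrM.
have h1 := norm_pserB_le w N d w2; have h2 := norm_qser_le w N d w2.
have h3 : `|sin (w * d)| <= `|w| * d.
  by apply: le_trans (le_abs_sin _) _; rewrite normrM [`|d|]ger0_norm.
have h4 := cos_max (w * d).
rewrite [`|d|]ger0_norm// in h1.
have v2 : w ^+ 2 <= 1 / 4.
  by move: w2; rewrite ler_norml => /andP[? ?]; nra.
have vd : w ^+ 2 * d <= 1 / 4 * d by rewrite ler_wpM2r.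
have ac : `|pser w N d - pser 0 N d| * `|cos (w * d)| <= w ^+ 2 * (8 / 3) * d.
  by apply: le_trans h1; rewrite ler_piMr.
have bs : `|qser w N d| * `|sin (w * d)| <= w ^+ 2 * (8 / 3) * d.
  have -> : w ^+ 2 * (8 / 3) * d = `|w| * (8 / 3) * (`|w| * d).
    by rewrite -[w ^+ 2]ger0_norm ?sqr_ge0// normrX; ring.
  by rewrite ler_pM.
by apply: le_trans (lerD ac bs) _; lra.
Qed.

(* [xser w N] is asymptotically constant on [(0, pi)]; its value is read off as
   [x] tends to [0], where the series for [w] and for [0] differ by [O(x)]. *)
Lemma xser_cvg w x : `|w| <= 2^-1 -> 0 < x < pi ->
  (fun N => xser w N x) @ \oo --> pi / 4.
Proof.
move=> w2 xpi; apply/cvgrPdist_le => e e0.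
have pi2 := pi_ge2 R.
(* The errors below add up to [e/4 + 2 d + e/4 + d], which is less than [e] when [d <= e / 8]. *)
have [d d0 [d1 de]] : exists2 d : R, 0 < d & d < pi /\ d <= e / 8.
  have [e8|e8] := leP (e / 8) 1; [exists (e / 8)|exists 1]; do ?split; lra.
have dpi : 0 < d < pi by rewrite d0.
have c1 := xser_osc_cvg w d x w2 dpi xpi.
have c2 := pser0_cvg d dpi.
have e4 : 0 < e / 4 by lra.
have n1 := cvgr_dist_le _ _ c1 _ e4.
have n2 := cvgr_dist_le _ _ c2 _ e4.
near=> N.
have b1 : `|0 - (xser w N x - xser w N d)| <= e / 4 by near: N; exact: n1.
have b2 : `|pi / 4 - pser 0 N d| <= e / 4 by near: N; exact: n2.
have b3 := xser_near0 w N d w2 (ltW d0).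
have b4 := dist_cos_1 (w * d); have b5 := cos_max (w * d).
have b6 : `|w * d| <= d.
  rewrite normrM [`|d|]gtr0_norm// ler_piMl ?(ltW d0)//.
  by apply: le_trans w2 _; rewrite invf_le1// ler1n.
have -> : pi / 4 - xser w N x = (0 - (xser w N x - xser w N d))
  - (xser w N d - pser 0 N d * cos (w * d))
  + (pi / 4 - pser 0 N d) * cos (w * d) - pi / 4 * (cos (w * d) - 1) by ring.
have t1 : `|(pi / 4 - pser 0 N d) * cos (w * d)| <= e / 4.
  by apply: le_trans b2; rewrite normrM ler_piMr.
have t2 : `|pi / 4 * (cos (w * d) - 1)| <= d.
  rewrite normrM; apply: le_trans (le_trans b4 b6); rewrite ler_piMl//.
  by rewrite ger0_norm; have := pihalf_lt2 R; lra.
apply: le_trans (ler_normB _ _) _; apply: le_trans (lerD (ler_normD _ _) (lexx _)) _.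
apply: le_trans (lerD (lerD (ler_normB _ _) (lexx _)) (lexx _)) _.
by move: b1 b3 t1 t2; lra.
Unshelve. all: by end_near. Qed.

Lemma qser_pihalf w N : qser w N (pi / 2) = 0 :> R.
Proof. by rewrite /qser big1// => j _; rewrite cos_odd_pihalf mulr0 mul0r. Qed.

Lemma cos_half_gt0 w : `|w| <= 2^-1 -> 0 < cos (w * (pi / 2)).
Proof.
move=> w2; apply: cos_gt0_pihalf; have := pi_gt0 R => p0.
by move: w2; rewrite ler_norml => /andP[? ?]; apply/andP; split; nra.
Qed.

(** At [pi / 2] every cosine in [qser] vanishes, so there [yser] is [xser] times [tan (w pi / 2)];
    the limit of [xser] is thus transferred. *)
Lemma yser_cvg w x : `|w| <= 2^-1 -> 0 < x < pi ->
  (fun N => yser w N x) @ \oo --> pi / 4 * sin (w * (pi / 2)) / cos (w * (pi / 2)).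
Proof.
move=> w2 xpi; have c0 := cos_half_gt0 w w2.
apply: (cvg_sub_cvg _ (fun N => yser w N (pi / 2))).
  exact: yser_osc_cvg pihalf_in xpi.
have E N : yser w N (pi / 2) = xser w N (pi / 2) * (sin (w * (pi / 2)) / cos (w * (pi / 2))).
  rewrite /yser /xser qser_pihalf !mul0r subr0 addr0; field.
  by rewrite gt_eqF.
under eq_fun => N do rewrite E.
by rewrite -mulrA; apply: cvgM (xser_cvg w _ w2 pihalf_in) (cvg_cst _).
Qed.

Lemma pser_cvg w x : `|w| <= 2^-1 -> 0 < x < pi ->
  (fun N => pser w N x) @ \oo --> pi / 4 * (cos (w * (pi / 2 - x)) / cos (w * (pi / 2))).
Proof.
move=> w2 xpi; have c0 := cos_half_gt0 w w2; have cs := cos2Dsin2 (w * x).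
have E N : pser w N x = xser w N x * cos (w * x) + yser w N x * sin (w * x).
  rewrite -[LHS]mulr1 -cs /xser /yser; ring.
under eq_fun => N do rewrite E.
have -> : pi / 4 * (cos (w * (pi / 2 - x)) / cos (w * (pi / 2))) =
  pi / 4 * cos (w * x) + pi / 4 * sin (w * (pi / 2)) / cos (w * (pi / 2)) * sin (w * x).
  by rewrite mulrBr cosB; field; rewrite gt_eqF.
by apply: cvgD; apply: cvgM (cvg_cst _); [exact: xser_cvg|exact: yser_cvg].
Qed.

Lemma qser_cvg w x : `|w| <= 2^-1 -> 0 < x < pi ->
  (fun N => qser w N x) @ \oo --> pi / 4 * (sin (w * (pi / 2 - x)) / cos (w * (pi / 2))).
Proof.
move=> w2 xpi; have c0 := cos_half_gt0 w w2; have cs := cos2Dsin2 (w * x).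
have E N : qser w N x = yser w N x * cos (w * x) - xser w N x * sin (w * x).
  rewrite -[LHS]mulr1 -cs /xser /yser; ring.
under eq_fun => N do rewrite E.
have -> : pi / 4 * (sin (w * (pi / 2 - x)) / cos (w * (pi / 2))) =
  pi / 4 * sin (w * (pi / 2)) / cos (w * (pi / 2)) * cos (w * x) - pi / 4 * sin (w * x).
  by rewrite mulrBr sinB; field; rewrite gt_eqF.
by apply: cvgB; apply: cvgM (cvg_cst _); [exact: yser_cvg|exact: xser_cvg].
Qed.

End Limits.

(** * Euler and class numbers *)

Lemma norm_jacobi_le1 a l : `|jacobi a l| <= 1.
Proof.
rewrite /jacobi; elim/big_ind: _ => [|x y x1 y1|f _]; first by rewrite normr1.
  by rewrite normrM mulr_ile1.
rewrite normrX exprn_ile1// /legendre; case: ifP => _; first by rewrite normr0.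
by case: ifP => _; rewrite ?normrN normr1.
Qed.

Section Characters.
Context {R : realType} {m t : nat} (mt : m = (4 * t + 3)%N).

Lemma jacobi_pos_upper j : jacobi m%:Z j.*2.+1 = (-1) ^+ j * jacobi (j.*2.+1)%:Z m.
Proof.
have oj : odd j.*2.+1 by rewrite /= odd_double.
have om : odd m by lia.
rewrite (jacobi_reciprocity (R := R) m _ om oj); congr (_ * _).
rewrite -[LHS]signr_odd -[RHS]signr_odd; congr (_ ^+ nat_of_bool _).
have -> : (j.*2.+1)./2 = j by lia.
by rewrite oddM; have -> : odd m./2 by lia.
Qed.

Lemma jacobi_neg_upper j : jacobi (- m%:Z) j.*2.+1 = jacobi (j.*2.+1)%:Z m.
Proof.
have oj : odd j.*2.+1 by rewrite /= odd_double.
rewrite -mulN1r jacobiMl// jacobiN1// jacobi_pos_upper mulrA.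
have -> : (j.*2.+1)./2 = j by lia.
by rewrite -expr2 sqrr_sign mul1r.
Qed.

End Characters.

(** * Reflection of angles and the geometric series in [w] *)

Section ZSeries.
Context {R : realType}.
Implicit Types (w x : R) (N j : nat).
Local Notation odd_num j := (j.*2.+1%:R : R).

Lemma sin_odd_reflect j x : sin (odd_num j * (pi - x)) = sin (odd_num j * x).
Proof.
have -> : odd_num j * (pi - x) = (pi - odd_num j * x) + pi *+ 2 *+ j.
  by rewrite -natr1 -mul2n natrM -[_ *+ j]mulr_natr -[pi *+ 2]mulr_natr; ring.
rewrite (periodicn (@sinD2pi R)) sinB sinpi cospi; ring.
Qed.

(** This is [qser] at [pi / 2 - x], since [cos (l (pi/2 - x)) = (-1)^j sin (l x)] for
    [l = 2 j + 1]. *)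
Definition rser w N x : R :=
  \sum_(j < N) (-1) ^+ j * w * sin (odd_num j * x) / (odd_num j ^+ 2 - w ^+ 2).

Lemma rser_cvg w x : `|w| <= 2^-1 -> 0 < x < pi / 2 ->
  (fun N => rser w N x) @ \oo --> pi / 4 * (sin (w * x) / cos (w * (pi / 2))).
Proof.
move=> w2 /andP[x0 xp]; have := qser_cvg w (pi / 2 - x) w2.
have -> : pi / 2 - (pi / 2 - x) = x by ring.
have xpi : 0 < pi / 2 - x < pi by apply/andP; split; lra.
move=> /(_ xpi); apply: cvg_trans; apply: near_eq_cvg; apply: nearW => N.
apply: eq_bigr => j _; rewrite mulrBr cosB cos_odd_pihalf sin_odd_pihalf mul0r add0r.
by rewrite mulrA [w * _]mulrC.
Qed.

Lemma rser_reflect w N x : rser w N (pi - x) = rser w N x.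
Proof. by apply: eq_bigr => j _; rewrite sin_odd_reflect. Qed.

Lemma pser_reflect w N x : pser w N (pi - x) = pser w N x.
Proof. by apply: eq_bigr => j _; rewrite sin_odd_reflect. Qed.

(** [Lambda] in other variables: with [w = 2 m y / pi] and [x = pi p / (2 m)] it equals
    [Lambda m p y]. *)
Definition half_lambda w x : R :=
  (cos (w * (pi / 2 - x)) + sin (w * x)) / cos (w * (pi / 2)).

Lemma prser_cvg w x : `|w| <= 2^-1 -> 0 < x < pi / 2 ->
  (fun N => pser w N x + rser w N x) @ \oo --> pi / 4 * half_lambda w x.
Proof.
move=> w2 xp; have xpi : 0 < x < pi.
  case/andP: xp => x0 xp; rewrite x0 (lt_trans xp)//.
  by case/andP: (pihalf_in (R := R)).
have -> : pi / 4 * half_lambda w x = pi / 4 * (cos (w * (pi / 2 - x)) / cos (w * (pi / 2))) +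
    pi / 4 * (sin (w * x) / cos (w * (pi / 2))) by rewrite /half_lambda; ring.
exact: cvgD (pser_cvg w x w2 xpi) (rser_cvg w x w2 xp).
Qed.

(** [rser_cvg] stops at [pi / 2], because [qser_cvg] is applied at [pi / 2 - x]; sines of odd
    multiples are symmetric about [pi / 2]. *)
Lemma prser_reflect_cvg w x : `|w| <= 2^-1 -> pi / 2 < x < pi ->
  (fun N => pser w N x + rser w N x) @ \oo --> pi / 4 * half_lambda w (pi - x).
Proof.
move=> w2 /andP[xp xpi]; under eq_fun => N do rewrite -pser_reflect -rser_reflect.
by apply: prser_cvg => //; apply/andP; split; lra.
Qed.

(** The ratio of the symbol occurring in [s_{m,n}] to [(l / m)], for [l = 2 j + 1]. *)
Definition alt_sign (n j : nat) : R := if odd n then (-1) ^+ j else 1.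

Lemma alt_signSS n j : alt_sign n.+2 j = alt_sign n j.
Proof. by rewrite /alt_sign/= negbK. Qed.

Lemma norm_alt_sign n j : `|alt_sign n j| = 1.
Proof. by rewrite /alt_sign; case: odd; rewrite ?normr1// normrX normrN normr1 expr1n. Qed.

Lemma alt_geometric_sum w N j : `|w| <= 2^-1 ->
  \sum_(n < N) w ^+ n * (alt_sign n j / odd_num j ^+ n.+1) =
  ((odd_num j + (-1) ^+ j * w) - (alt_sign N j * odd_num j + alt_sign N.+1 j * w) *
    (w / odd_num j) ^+ N) / (odd_num j ^+ 2 - w ^+ 2).
Proof.
move=> w2; have d0 := odd_den_gt0 w j w2; have l1 := odd_num_ge1 (R := R) j.
have l0 := lt_le_trans ltr01 l1.
elim: N => [|N IH].
  by rewrite big_ord0 expr0 mulr1 /alt_sign/= mul1r subrr mul0r.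
rewrite big_ord_recr/= IH alt_signSS.
move: (alt_sign N j) (alt_sign N.+1 j) ((-1) ^+ j) d0 l0 => a b c.
move: (odd_num j) => l d0 l0; rewrite (exprS l N) (exprS (w / l) N) expr_div_n.
move: (w ^+ N) (expf_neq0 N (negbT (gt_eqF l0))); move: (l ^+ N) => u v u0.
by field; rewrite u0 !gt_eqF.
Qed.

End ZSeries.

Lemma cvg_ord_sum {R : realType} K (u : nat -> nat -> R) (l : nat -> R) :
  (forall i, (i < K)%N -> u i @ \oo --> l i) ->
  (fun N => \sum_(i < K) u i N) @ \oo --> \sum_(i < K) l i.
Proof.
elim: K => [|K IH] ul.
  by under eq_fun => N do rewrite big_ord0; rewrite big_ord0; exact: cvg_cst.
under eq_fun => N do rewrite big_ord_recr/=; rewrite big_ord_recr/=.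
by apply: cvgD; [apply: IH => i iK; apply: ul; exact: ltnW|exact: ul].
Qed.

(** * Summation of the generating series *)

Section EulerClassNumbers.
Context {R : realType} {m t : nat} (mt : m = (4 * t + 3)%N) (mS : square_free m).
Implicit Types (w x : R) (N M j k n : nat).
Local Notation odd_num j := (j.*2.+1%:R : R).

Let X l : R := (jacobi l%:Z m)%:~R.

Let norm_X l : `|X l| <= 1.
Proof. by rewrite /X -intr_norm -[1]/(1%:~R) ler_int norm_jacobi_le1. Qed.

Let m_gt0 : (0 : R) < m%:R. Proof. by rewrite ltr0n mt addn3. Qed.

Let angle k : R := pi *+ 2 * k.+1%:R / m%:R.

Definition zser w N : R :=
  \sum_(j < N) X j.*2.+1 * ((odd_num j + (-1) ^+ j * w) / (odd_num j ^+ 2 - w ^+ 2)).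

Lemma sqrt_zser w N : zser w N * Num.sqrt m%:R =
  2 * \sum_(k < (2 * t).+1) X k.+1 * (pser w N (angle k) + rser w N (angle k)).
Proof.
rewrite mulr_suml mulr_sumr.
under [RHS]eq_bigr => k _ do rewrite -big_split/= mulrA mulr_sumr.
rewrite exchange_big/=; apply: eq_bigr => j _.
rewrite mulrAC -(half_sum_jacobi_sin m t _ mt mS) -mulrA mulr_suml mulr_sumr.
apply: eq_bigr => k _.
have -> : pi *+ 2 * (k.+1 * j.*2.+1)%:R / m%:R = odd_num j * angle k.
  by rewrite /angle natrM; ring.
rewrite /X; move: (_%:~R) (sin _) (_^-1) ((-1) ^+ j) => a s d e.
by ring.
Qed.

(** Index [k] stands for the residue [k + 1]. Its angle is below [pi / 2] when
    [4 (k + 1) < 4 t + 3], that is [k < t], and is never equal to [pi / 2] as [m] is odd. *)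
Let zlim w : R := \sum_(k < (2 * t).+1)
  X k.+1 * half_lambda w (if (k < t)%N then angle k else pi - angle k).

Lemma zser_cvg w : `|w| <= 2^-1 ->
  zser w @ \oo --> 2 / Num.sqrt m%:R * (pi / 4) * zlim w.
Proof.
move=> w2; have s0 : Num.sqrt m%:R != 0 :> R by rewrite sqrtr_eq0 -ltNge.
have -> : zser w = fun N => 2 / Num.sqrt m%:R *
    \sum_(k < (2 * t).+1) X k.+1 * (pser w N (angle k) + rser w N (angle k)).
  by apply/funext => N; apply: (mulIf s0); rewrite sqrt_zser mulrAC divfK.
rewrite -mulrA mulr_sumr; apply: cvgM; first exact: cvg_cst.
apply: (cvg_ord_sum _ (fun k N => X k.+1 * (pser w N (angle k) + rser w N (angle k)))
  (fun k => pi / 4 * (X k.+1 * half_lambda w (if (k < t)%N then angle k else pi - angle k)))).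
move=> k kt; rewrite mulrCA; apply: cvgM; first exact: cvg_cst.
have p0 := pi_gt0 R.
have aE : angle k = pi * ((2 * k.+1)%:R / m%:R) by rewrite /angle natrM; ring.
have a0 : 0 < (2 * k.+1)%:R / m%:R :> R by rewrite divr_gt0// ltr0n.
case: ltnP => tk.
  apply: prser_cvg => //; rewrite aE; have : (2 * k.+1)%:R / m%:R < 2^-1 :> R.
    by rewrite ltr_pdivrMr// ltr_pdivlMl// -natrM ltr_nat; lia.
  by move: (_ / _) a0 => a a0 a2; apply/andP; split; nra.
apply: prser_reflect_cvg => //; rewrite aE; have a2 : 2^-1 < (2 * k.+1)%:R / m%:R :> R.
  by rewrite ltr_pdivlMr// ltr_pdivrMl// -natrM ltr_nat; lia.
have : (2 * k.+1)%:R / m%:R < 1 :> R by rewrite ltr_pdivrMr// mul1r ltr_nat; lia.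
by move: (_ / _) a0 a2 => a a0 a1 a2; apply/andP; split; nra.
Qed.

Definition lterm n j : R := X j.*2.+1 * (alt_sign n j / odd_num j ^+ n.+1).

(** Uniformity in [M] is what permits exchanging the sums over [n] and [l]. The remainder of the
    geometric sum has numerator at most [2 l (|w| / l)^(N+1)], hence at most [2 |w|^(N+1)], and the
    reciprocal denominators sum to at most [8/3]. *)
Lemma lterm_sum w N M : `|w| <= 2^-1 ->
  `|\sum_(n < N.+1) w ^+ n * series (lterm n) M - zser w M| <= 16 / 3 * `|w| ^+ N.+1.
Proof.
move=> w2.
have -> : \sum_(n < N.+1) w ^+ n * series (lterm n) M = \sum_(j < M) X j.*2.+1 *
    \sum_(n < N.+1) w ^+ n * (alt_sign n j / odd_num j ^+ n.+1).
  under eq_bigr => n _ do rewrite /series/= big_mkord mulr_sumr.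
  rewrite exchange_big/=; apply: eq_bigr => j _; rewrite mulr_sumr.
  by apply: eq_bigr => n _; rewrite /lterm mulrCA.
rewrite /zser -sumrB; apply: le_trans (ler_norm_sum _ _ _) _.
apply: (@le_trans _ _ (2 * `|w| ^+ N.+1 * \sum_(j < M) (odd_num j ^+ 2 - w ^+ 2)^-1)); last first.
  have -> : 16 / 3 * `|w| ^+ N.+1 = 2 * `|w| ^+ N.+1 * (8 / 3) by ring.
  by rewrite ler_wpM2l ?mulr_ge0 ?exprn_ge0// sum_inv_odd_den_le.
rewrite mulr_sumr; apply: ler_sum => j _; rewrite alt_geometric_sum// -mulrBr normrM.
have d0 := odd_den_gt0 w j w2; have l1 := odd_num_ge1 (R := R) j.
have n1 := norm_alt_sign (R := R) N.+1 j; have n2 := norm_alt_sign (R := R) N.+2 j.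
rewrite -mulrBl normrM normfV [`|_ - w ^+ 2|]gtr0_norm// mulrA ler_wpM2r ?invr_ge0 ?(ltW d0)//.
apply: (@le_trans _ _ (1 * `|- ((alt_sign N.+1 j * odd_num j + alt_sign N.+2 j * w) *
    (w / odd_num j) ^+ N.+1)|)).
  rewrite ler_pM//; last by rewrite addrAC subrr add0r.
rewrite mul1r normrN normrM normrX normrM normfV.
have l0 := lt_le_trans ltr01 l1.
rewrite [`|odd_num j|]gtr0_norm// expr_div_n mulrA ler_pdivrMr ?exprn_gt0//.
rewrite mulrAC ler_wpM2r ?exprn_ge0//.
apply: (@le_trans _ _ (odd_num j + `|w|)).
  by apply: le_trans (ler_normD _ _) _; rewrite !normrM n1 n2 !mul1r gtr0_norm.
apply: (@le_trans _ _ (2 * odd_num j)).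
  have : 2^-1 <= 1 :> R by rewrite invf_le1// ler1n.
  by move: w2 l1; move: (odd_num j) `|w| => l v *; lra.
by rewrite ler_wpM2l// exprS ler_peMr ?(ltW l0)// exprn_ege1.
Qed.

(** For [n = 0], without absolute convergence, the partial sums are [zser 0], whose limit is known;
    for larger [n] the terms are dominated by [1 / l^2]. *)
Lemma lterm_cvg n : cvgn (series (lterm n)).
Proof.
case: n => [|n].
  have w0 : `|0 : R| <= 2^-1 by rewrite normr0 invr_ge0.
  suff -> : series (lterm 0) = zser 0 by apply/cvg_ex; eexists; exact: zser_cvg.
  apply/funext => N; rewrite /series/= big_mkord; apply: eq_bigr => j _.
  rewrite /lterm /alt_sign/= expr0n subr0 mulr0 addr0 expr1 expr2; congr (_ * _).
  have := odd_num_ge1 (R := R) j; move: (odd_num j) => l l1.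
  by field; rewrite gt_eqF// (lt_le_trans ltr01).
apply: normed_cvg; apply: (@series_le_cvg _ _ (fun j => (odd_num j ^+ 2)^-1)) => [j|j|j|].
- exact: normr_ge0.
- by rewrite invr_ge0 sqr_ge0.
- have l1 := odd_num_ge1 (R := R) j; have l0 := lt_le_trans ltr01 l1.
  rewrite /= /lterm normrM normrM norm_alt_sign mul1r normfV [`|_ ^+ _|]gtr0_norm ?exprn_gt0//.
  rewrite -[X in _ <= X]mul1r ler_pM ?norm_X ?invr_ge0 ?exprn_ge0 ?(ltW l0)//.
  by rewrite lef_pV2 ?posrE ?exprn_gt0// ler_weXn2l.
apply: nondecreasing_is_cvgn.
  by apply: nondecreasing_series => j _ _; rewrite invr_ge0 sqr_ge0.
by exists 2 => _ [N _ <-]; rewrite /series/= big_mkord sum_inv_odd_sqr.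
Qed.

Let lval n : R := limn (series (lterm n)).

(** The number of [l] terms tends to infinity in [lterm_sum] at fixed [N]; then [N] grows and
    [|w|^(N+1)] tends to [0]. *)
Lemma lval_sum_cvg w : `|w| <= 2^-1 ->
  (fun N => \sum_(n < N) w ^+ n * lval n) @ \oo --> 2 / Num.sqrt m%:R * (pi / 4) * zlim w.
Proof.
move=> w2; rewrite -cvg_shiftS.
apply: (@cvg_dist_le _ _ (fun N => 16 / 3 * `|w| ^+ N.+1)) => [N|]; last first.
  rewrite -(mulr0 (16 / 3)); apply: cvgM; first exact: cvg_cst.
  rewrite (cvg_shiftS (fun n => `|w| ^+ n)); apply: cvg_expr.
  by rewrite normr_id (le_lt_trans w2)// invf_lt1// ltr1n.
have c1 : (fun M => \sum_(n < N.+1) w ^+ n * series (lterm n) M) @ \oo -->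
    \sum_(n < N.+1) w ^+ n * lval n.
  apply: (cvg_ord_sum _ (fun n M => w ^+ n * series (lterm n) M) (fun n => w ^+ n * lval n)).
  move=> n _.
  by apply: cvgM; [exact: cvg_cst|exact: lterm_cvg].
have c2 : (fun M => `|\sum_(n < N.+1) w ^+ n * series (lterm n) M - zser w M|) @ \oo -->
    `|\sum_(n < N.+1) w ^+ n * lval n - 2 / Num.sqrt m%:R * (pi / 4) * zlim w|.
  by apply: cvg_norm; apply: cvgB c1 _; exact: zser_cvg.
by apply: (cvgr_to_le c2); apply: nearW => M /=; exact: lterm_sum.
Qed.

(** The exponent of [2 m / pi] exceeds [n] by one; that extra factor divided by [sqrt m] is
    [2 sqrt m / pi]. Here [K_m = 1], as [m >= 3]. *)
Lemma snum_term n x : snum R m n * (x ^+ n / n`!%:R) =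
  2 * Num.sqrt m%:R / pi * ((2 * m%:R * x / pi) ^+ n * lval n).
Proof.
have m1 : (m == 1)%N = false by apply/negbTE; lia.
have -> : snum R m n = n`!%:R * lval n * (Num.sqrt m%:R)^-1 * (pi / (2 * m%:R)) ^- n.+1.
  rewrite /snum; case: (boolP (odd n)) => on.
    rewrite /dnum /Kconst m1 mul1r; have -> : (2 * n.+1./2 = n.+1)%N by lia.
    rewrite subn1/=; congr (_ * _ * _ * _); rewrite /dirichletL /lval; congr (limn (series _)).
    apply/funext => j; rewrite opprK (jacobi_pos_upper (R := R) mt) /lterm /alt_sign on.
    by rewrite intrM rmorph_sign mulrCA mulrA.
  rewrite /cnum /Kconst m1 mul1r; have -> : (2 * n./2 = n)%N by lia.
  rewrite addn1; congr (_ * _ * _ * _); rewrite /dirichletL /lval; congr (limn (series _)).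
  apply/funext => j; rewrite (jacobi_neg_upper (R := R) mt) /lterm /alt_sign (negPf on).
  by rewrite mul1r.
have s0 : Num.sqrt m%:R != 0 :> R by rewrite sqrtr_eq0 -ltNge.
have sm : m%:R = Num.sqrt m%:R ^+ 2 :> R by rewrite sqr_sqrtr// ltW.
have p0 : pi != 0 :> R by rewrite gt_eqF// pi_gt0.
have f0 : n`!%:R != 0 :> R by rewrite pnatr_eq0 -lt0n fact_gt0.
have -> : 2 * m%:R * x / pi = (pi / (2 * m%:R))^-1 * x by rewrite invf_div; ring.
move: s0 sm; set s := Num.sqrt _ => s0 sm; set q := pi / (2 * m%:R).
have qV : q^-1 = 2 * s ^+ 2 / pi by rewrite /q invf_div -sm.
rewrite (exprS q n) invfM (exprMn _ q^-1) exprVn qV.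
move: (lval n) ((q ^+ n)^-1) (x ^+ n) => L r y.
move: (n`!%:R) f0 => f f0; move: (pi) p0 => p p0; move: (s : R) s0 => s' s0'.
by field; rewrite s0' p0 f0.
Qed.

Lemma Lambda_half_lambda k x : Lambda m%:Z (4 * k.+1%:Z) x = half_lambda (2 * m%:R * x / pi) (angle k).
Proof.
have p0 : pi != 0 :> R by rewrite gt_eqF// pi_gt0.
have m0 : m%:R != 0 :> R by rewrite gt_eqF.
have e4 : (4 * k.+1%:Z)%:~R = 4 * k.+1%:R :> R by rewrite intrM.
rewrite /Lambda /half_lambda /angle intrB e4 -!pmulrn -[pi *+ 2]mulr_natr.
move: (pi) p0 (m%:R) m0 (k.+1%:R) => p p0 u u0 v.
by congr ((cos _ + sin _) / cos _); field; rewrite ?p0 ?u0.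
Qed.

Lemma Lambda_half_lambda_reflect k x :
  Lambda m%:Z (2 * m%:Z - 4 * k.+1%:Z) x = half_lambda (2 * m%:R * x / pi) (pi - angle k).
Proof.
have p0 : pi != 0 :> R by rewrite gt_eqF// pi_gt0.
have m0 : m%:R != 0 :> R by rewrite gt_eqF.
have e4 : (4 * k.+1%:Z)%:~R = 4 * k.+1%:R :> R by rewrite intrM.
have e2 : (2 * m%:Z)%:~R = 2 * m%:R :> R by rewrite intrM.
rewrite /Lambda /half_lambda /angle !intrB e4 e2 -!pmulrn -[pi *+ 2]mulr_natr.
move: (pi) p0 (m%:R) m0 (k.+1%:R) => p p0 u u0 v.
by congr ((cos _ + sin _) / cos _); field; rewrite ?p0 ?u0.
Qed.

Lemma zlimE x : zlim (2 * m%:R * x / pi) =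
  \sum_(1 <= k < t.+1) (jacobi k%:Z m)%:~R * Lambda m%:Z (4 * k%:Z) x
  + \sum_(t.+1 <= k < (2 * t + 1).+1)
      (jacobi k%:Z m)%:~R * Lambda m%:Z (2 * m%:Z - 4 * k%:Z) x.
Proof.
rewrite /zlim -(big_mkord xpredT (fun k => X k.+1 *
  half_lambda (2 * m%:R * x / pi) (if (k < t)%N then angle k else pi - angle k))).
rewrite (big_cat_nat (n := t))//=; last by lia.
rewrite !big_add1 addn1/=; congr (_ + _).
  apply: eq_big_nat => k /andP[_ kt]; by rewrite kt Lambda_half_lambda.
by apply: eq_big_nat => k /andP[kt _]; rewrite ltnNge kt/= Lambda_half_lambda_reflect.
Qed.

Lemma sseries_cvg x : `|2 * m%:R * x / pi| <= 2^-1 ->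
  sseries m x @ \oo --> zlim (2 * m%:R * x / pi).
Proof.
move=> w2; set w := 2 * m%:R * x / pi in w2 *.
have s0 : Num.sqrt m%:R != 0 :> R by rewrite sqrtr_eq0 -ltNge.
have p0 : pi != 0 :> R by rewrite gt_eqF// pi_gt0.
have E : sseries m x = fun N => 2 * Num.sqrt m%:R / pi * \sum_(n < N) w ^+ n * lval n.
  apply/funext => N; rewrite /sseries /series/= big_mkord mulr_sumr.
  by apply: eq_bigr => n _; rewrite snum_term.
have -> : zlim w = 2 * Num.sqrt m%:R / pi * (2 / Num.sqrt m%:R * (pi / 4) * zlim w).
  by move: (pi) p0 (Num.sqrt _) s0 (zlim w) => p p0 s s0 z; field; rewrite ?s0 ?p0.
by rewrite E; apply: cvgM; [exact: cvg_cst|exact: lval_sum_cvg].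
Qed.

End EulerClassNumbers.

Theorem theorem2p1 (R : realType) (m t : nat)
    (hm0 : (0 < m)%N) (hm : square_free m) (hmt : m = (4 * t + 3)%N) :
  \forall x \near (0 : R),
    sseries m x @ \oo -->
      (\sum_(1 <= k < t.+1) (jacobi k%:Z m)%:~R * Lambda m%:Z (4 * k%:Z) x
       + \sum_(t.+1 <= k < (2 * t + 1).+1)
           (jacobi k%:Z m)%:~R * Lambda m%:Z (2 * m%:Z - 4 * k%:Z) x : R).
Proof.
have p0 := pi_gt0 R; have m0 : (0 : R) < m%:R by rewrite ltr0n.
(* On [|x| < pi / (4 m)] the variable [w = 2 m x / pi] satisfies [|w| < 1/2]. *)
have e0 : 0 < pi / (4 * m%:R) :> R by rewrite divr_gt0// mulr_gt0.
near=> x; rewrite -zlimE//; apply: sseries_cvg => //.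
have : `|x| < pi / (4 * m%:R) by near: x; exact: (@nbhs0_lt R R^o _ e0).
rewrite ltr_pdivlMr ?mulr_gt0// => xm.
rewrite normrM normfV [`|pi|]gtr0_norm// ler_pdivrMr// normrM [`|2 * _|]gtr0_norm ?mulr_gt0//.
by lra.
Unshelve. all: by end_near. Qed.
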